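(* Let $\bm V=\bm C\cup\{D,U\}$, where $\bm C=\{C_1,\dots,C_N\}$ is a finite set of chance variables with finite domains, $D$ is a decision variable with finite domain and $U$ is a utility variable. For almost all causal influence diagrams $M=(G,P)$ over $\bm V$ satisfying - (Assumption 1, unmediated decision task) $\mathrm{Desc}_D\cap \mathrm{Anc}_U=\emptyset$, and - (Assumption 2, domain dependence) there exist environment distributions $P_1(\bm C=\bm c)$ and $P_2(\bm C=\bm c)$ compatible with $M$ such that no policy maximising $\mathbb E^{\pi}_{P_1}[U]$ also maximises $\mathbb E^{\pi}_{P_2}[U]$, one can identify an approximate causal model $M'=(P',G')$ given a family $\{\pi_\sigma(d\mid\mathrm{pa}_D)\}_{\sigma\in\Sigma}$ of policies satisfying $\mathbb E^{\pi_\sigma}[U]\ge \mathbb E^{\pi^*_\sigma}[U]-\delta$ for every $\sigma\in\Sigma$ (expected utilities taken in the domain $\sigma$, with $\pi^*_\sigma$ an optimal policy in that domain), where $\Sigma$ is the set of mixtures of local interventions. The parameters of $M'$ satisfy $$\left|P'(v_i\mid \mathrm{pa}_i)-P(v_i\mid\mathrm{pa}_i)\right|\le\gamma(\delta)\qquad\text{for all } V_i\in\bm V,$$ where $\gamma(0)=0$ and $\gamma(\delta)$ grows linearly in $\delta$ for small regret $\delta\ll\mathbb E^{\pi^*}[U]$.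
   Context: **Causal influence diagram (CID).** A (single-decision, single-utility) CID $M=(G,P)$ is a causal Bayesian network whose variables are partitioned into chance variables $\bm C$, a decision $D$ and a utility $U$. It consists of a DAG $G$ on $\bm V=\bm C\cup\{D,U\}$, conditional probability distributions $P(v_i\mid \mathrm{pa}_i)$ of variables given their parents in $G$, and a real-valued function $U(\mathrm{pa}_U)$ giving the utility as a function of the values of its parents. The conditional distribution of $D$ is not a fixed parameter of the model; it is the policy, set by the agent. $\mathrm{Pa}_D\subseteq\bm C$. For a node $X$, $\mathrm{Pa}_X,\mathrm{Anc}_X,\mathrm{Desc}_X$ are its parents, proper ancestors and proper descendants in $G$. $\bm C$ is assumed causally sufficient (contains all common causes). The diagram is causal: interventions act by replacing the corresponding factors in $\prod_i P(v_i\mid\mathrm{pa}_i)$. The utility function is normalised to take values in $[0,1]$. **Policies.** A policy is a conditional distribution $\pi(d\mid \mathrm{pa}_D)$; $\mathbb E^\pi[U]$ is the resulting expected utility. A policy is optimal if it maximises $\mathbb E^\pi[U]$; the regret of $\pi$ is $\mathbb E^{\pi^*}[U]-\mathbb E^\pi[U]$ with $\pi^*$ optimal. **Compatible distributions.** An environment distribution is compatible with $M$ if it is given by some choice of conditional distributions of the $C_i$ given their parents in $G$ (same $G$ and same $U(\cdot)$). **Local interventions.** A local intervention on a chance variable $C_i$, written $\mathrm{do}(C_i=f(c_i))$, applies a map $f:\mathrm{dom}(C_i)\to\mathrm{dom}(C_i)$ to the states of $C_i$, i.e. it replaces $P(c_i\mid\mathrm{pa}_i)$ by $P(c_i\mid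 \mathrm{pa}_i;\sigma)=\sum_{c_i':f(c_i')=c_i}P(c_i'\mid\mathrm{pa}_i)$. Local interventions may be applied simultaneously to several chance variables. Hard interventions are the case of constant $f$. Masking of policy inputs, i.e. replacing $\mathrm{Pa}_D$ by a subset $\mathrm{Pa}_D'\subseteq\mathrm{Pa}_D$, is also counted as a local intervention. Interventions never act on $U$ and do not otherwise act on $D$. **Mixtures.** A mixture $\sigma^*=\sum_i p_i\sigma_i$ ($p_i\ge0$, $\sum_i p_i=1$) performs $\sigma_i$ with probability $p_i$: $P(\bm v;\sigma^* )=\sum_i p_iP(\bm v;\sigma_i)$. **Domain $\sigma$.** The environment after applying $\sigma$. **Identify.** $M'$ is determined from the family $\{\pi_\sigma\}_{\sigma\in\Sigma}$, with the set of variables, the utility function $U(\cdot)$ (with its argument set $\mathrm{Pa}_U$), $\mathrm{Pa}_D$ and the bound $\delta$ known; the graph $G$ and distribution $P$ are not known. **Approximate causal model.** $M'=(P',G')$ consists of a DAG $G'$ and conditional probabilities $P'(v_i\mid\cdot)$ of variables given their parents in $G'$. In $|P'(v_i\mid\mathrm{pa}_i)-P(v_i\mid\mathrm{pa}_i)|$, for every joint assignment $\bm v$, $P'$ is evaluated at the restriction of $\bm v$ to the parents of $V_i$ in $G'$ and $P$ at its restriction to the parents of $V_i$ in $G$. **Almost all.** With $G$ and the domains fixed, parameters are the free entries of the conditional probability tables $P(c_i\mid\mathrm{pa}_i)$ together with the values $U(\mathrm{pa}_U)$; ''almost all'' means outside a set of Lebesgue measure zero in this parameter space.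
   Formalization: The bound is stated only for V_i in Anc_U ∪ {U}, since the CPT of a chance variable that is not an ancestor of U (e.g. an isolated one) cannot be identified; every chance variable is assumed to have at least two states, and U to have no children. *)

(* Defs.v *)
From HB Require Import structures.
From mathcomp Require Import all_boot all_order all_algebra.
From mathcomp Require Import reals.

Set Implicit Arguments.
Unset Strict Implicit.
Unset Printing Implicit Defensive.

Import Order.TTheory GRing.Theory Num.Theory.
Local Open Scope ring_scope.

Record dist (R : realType) (T : finType) := Dist {
  mass :> {ffun T -> R};
  mass_ge0 : forall x, 0 <= mass x;
  mass_sum1 : \sum_x mass x = 1 }.

(* Lebesgue-null subsets of the finite-dimensional space I -> R: for every
   eps > 0 the set is covered by countably many closed boxes whose volumes
   add up to at most eps. *)
Definition lebesgue_null (R : realType) (I : finType) (N : (I -> R) -> Prop) :=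
  forall eps : R, 0 < eps ->
  exists a b : nat -> I -> R,
  [/\ forall k i, a k i <= b k i,
      forall x, N x -> exists k, forall i, a k i <= x i <= b k i
    & forall n, \sum_(k < n) \prod_i (b k i - a k i) <= eps].

Section Diagrams.
Variable C : finType.

(* C indexes the chance variables.  The variables with a finite domain are
   indexed by option C: Some i is the chance variable C_i, None the decision
   D.  The nodes of a diagram are indexed by option (option C), where the
   additional None is the utility U. *)
Definition node : finType := option (option C).
Definition chance (i : C) : node := Some (Some i).
Definition decision : node := Some None.
Definition utility : node := None.

Definition dipath (e : rel node) (x y : node) : bool :=
  [exists z, e x z && connect e z y].

(* The utility node of an influence diagram has no children. *)
Record diagram := Diagram {
  edge :> rel node;
  diagram_acyclic : forall x, ~~ dipath edge x x;
  utility_sink : forall x, ~~ edge utility x }.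

Definition Desc (G : diagram) (x : node) : {set node} := [set y | dipath G x y].
Definition Anc (G : diagram) (y : node) : {set node} := [set x | dipath G x y].

(* All parents are variables with a finite domain, by utility_sink. *)
Definition Pa (G : diagram) (x : node) : {set option C} :=
  [set w | G (Some w) x].

Definition unmediated (G : diagram) : Prop :=
  Desc G decision :&: Anc G utility = set0.

Variable dom : option C -> finType.

Definition assignment : finType := {dffun forall w : option C, dom w}.

Definition config (S : {set option C}) : finType :=
  {dffun forall w : {w : option C | w \in S}, dom (val w)}.

Definition restrict (S : {set option C}) (v : assignment) : config S :=
  [ffun w : {w : option C | w \in S} => v (val w)].

Variable R : realType.

Definition environment (G : diagram) : Type :=
  forall i : C, config (Pa G (chance i)) -> dist R (dom (Some i)).

Record cid (G : diagram) := Cid {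
  cpt : environment G;
  util : config (Pa G utility) -> R;
  util_range : forall c, 0 <= util c <= 1 }.

(* pi S c d is the probability of the decision d when the agent observes
   exactly the variables in S, with values c; the sets S that occur are Pa_D
   and, under masking, its subsets. *)
Definition policy : Type :=
  forall S : {set option C}, config S -> dist R (dom None).

(* s = (f, M): the map f i is applied to the states of each C_i (f i is the
   identity if C_i is not intervened on), and Pa_D is replaced by
   Pa_D :\: M. *)
Definition local_int : finType :=
  ({dffun forall i : C, {ffun dom (Some i) -> dom (Some i)}}
   * {set option C})%type.

Definition no_int : local_int :=
  ([ffun i : C => [ffun x : dom (Some i) => x]], set0).

Definition mixture : Type := dist R local_int.

Definition cpt_int (G : diagram) (P : environment G) (s : local_int)
    (i : C) (c : config (Pa G (chance i))) (y : dom (Some i)) : R :=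
  \sum_(x | s.1 i x == y) P i c x.

Definition joint (G : diagram) (P : environment G) (s : local_int)
    (pi : policy) (v : assignment) : R :=
  (\prod_i cpt_int P s (restrict (Pa G (chance i)) v) (v (Some i)))
  * pi _ (restrict (Pa G decision :\: s.2) v) (v None).

Definition joint_mix (G : diagram) (P : environment G) (p : mixture)
    (pi : policy) (v : assignment) : R :=
  \sum_s p s * joint P s pi v.

Definition EU (G : diagram) (U : config (Pa G utility) -> R)
    (P : environment G) (pi : policy) : R :=
  \sum_v joint P no_int pi v * U (restrict _ v).

Definition EU_mix (G : diagram) (U : config (Pa G utility) -> R)
    (P : environment G) (p : mixture) (pi : policy) : R :=
  \sum_v joint_mix P p pi v * U (restrict _ v).

Definition optimal (E : policy -> R) (pi : policy) : Prop :=
  forall pi', E pi' <= E pi.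

Definition regret_le (E : policy -> R) (delta : R) (pi : policy) : Prop :=
  exists2 pi_opt, optimal E pi_opt & E pi_opt - delta <= E pi.

Definition domain_dependent (G : diagram) (M : cid G) : Prop :=
  exists P1 P2 : environment G,
  forall pi, optimal (EU (util M) P1) pi -> ~ optimal (EU (util M) P2) pi.

(* Free parameters of a CID with graph G.  In each row of a conditional
   probability table the entry of the reference state r is determined by the
   other entries, which are free. *)
Definition free_param (G : diagram) (r : assignment) : finType :=
  ({i : C & (config (Pa G (chance i))
             * {x : dom (Some i) | x != r (Some i)})%type}
   + config (Pa G utility))%type.

Definition param (G : diagram) (r : assignment) (M : cid G)
    (t : free_param G r) : R :=
  match t with
  | inl (existT i cx) => cpt M cx.1 (val cx.2)
  | inr c => util M c
  end.

Definition almost_all (G : diagram) (r : assignment) (Q : cid G -> Prop) :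
    Prop :=
  exists2 N : (free_param G r -> R) -> Prop,
    lebesgue_null N & forall M, ~ N (@param G r M) -> Q M.

Definition model : Type := {G : diagram & cid G}.

(* What the identifier is given: Pa_D, Pa_U, U(.), delta and the policies. *)
Definition identifier : Type :=
  forall PaD PaU : {set option C},
  (config PaU -> R) -> R -> (mixture -> policy) -> model.

(* P(x | pa_x) at the joint assignment (v, u), where u is the value of U.  At
   the decision it is the policy of the agent, and at the utility the point
   mass at U(pa_U). *)
Definition cond_prob (G : diagram) (M : cid G) (pi : policy)
    (v : assignment) (u : R) (x : node) : R :=
  match x with
  | Some (Some i) => cpt M (restrict (Pa G (chance i)) v) (v (Some i))
  | Some None => pi _ (restrict (Pa G decision) v) (v None)
  | None => (u == util M (restrict (Pa G utility) v))%:R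
  end.

Definition linear_for_small_regret (G : diagram) (M : cid G) (gamma : R -> R) :
    Prop :=
  exists K eps : R, [/\ 0 < K, 0 < eps &
    forall pi, optimal (EU (util M) (cpt M)) pi ->
    forall delta, 0 <= delta <= eps * EU (util M) (cpt M) pi ->
    gamma delta = K * delta].

End Diagrams.

Arguments domain_dependent {C dom R G} M.
Arguments almost_all {C dom R} G r Q.

(* Main.v *)
(* The identifier returns any unmediated model that agrees with the data: same
   Pa_D, Pa_U and U(.), and every given policy is delta-optimal in it.  What
   has to be shown is stability: if M is generic and M' is another such model,
   their conditional probabilities at the ancestors of U differ by O(delta),
   with a constant depending on M only.

   From policies to expectations.  Domain dependence forbids a dominating
   decision, so two hard interventions c1, c2 have distinct strictly best
   decisions d1, d2.  For a local intervention f consider the mixtures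
   l f + (1 - l) (t do(c1) + (1 - t) do(c2)) with a small fixed l.  The optimal
   utility is the upper envelope of lines in t, one for each decision, with
   known slopes; M and M' have the same slopes and share delta-optimal policies
   for every t, so their envelopes grow by the same amount over [0, 1] up to
   O(delta).  At the ends d1 and d2 are active, hence
   E[U | d1; f] - E[U | d2; f] is the same in M and M' up to O(delta).

   From expectations to mechanisms.  Take a chordless path from C_i to a parent
   of U or of D, release its variables and fix all other chance variables at v.
   Sending one state x of C_i to n_i and all other states to r_i gives a
   contrast that is affine in P(x | pa_i(v)), with coefficients that are
   themselves observable contrasts; the slope is a product of differences of
   conditional probabilities along the path, nonzero for generic M.  Going
   backwards along the path, the estimates force each edge of the path to be an
   edge of G', so that the same formula holds in M'. *)

Require Import Defs.
From HB Require Import structures.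
From mathcomp Require Import all_boot all_order all_algebra.
From mathcomp Require Import reals ring lra.

Set Implicit Arguments.
Unset Strict Implicit.
Unset Printing Implicit Defensive.

Import Order.TTheory GRing.Theory Num.Theory.
Local Open Scope ring_scope.

(** * Upper envelopes with a common delta-optimal policy *)

Lemma finite_argmax (R : realType) (T : finType) (x0 : T) (f : T -> R) :
  exists x, forall y, f y <= f x.
Proof. by case: (@arg_maxP _ _ T x0 xpredT f isT) => x _ h; exists x => y; apply: h. Qed.

Lemma finite_pos_lower_bound (R : realType) (T : finType) (f : T -> R) :
  (forall x, 0 < f x) -> exists2 e : R, 0 < e & forall x, e <= f x.
Proof.
move=> f0.
have [x0|T0] := pickP (@predT T).
  have [x hx] := finite_argmax x0 (fun x => - f x).
  by exists (f x) => // y; rewrite -lerN2.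
by exists 1 => // x; have := T0 x.
Qed.

Lemma ler_archi (R : realType) (x y B : R) :
  (forall n : nat, x <= y + B / n.+1%:R) -> x <= y.
Proof.
move=> h; rewrite leNgt; apply/negP => yx.
have d0 : 0 < x - y by rewrite subr_gt0.
have B0 : 0 <= `|B| / (x - y) by rewrite divr_ge0 // ltW.
have := archi_boundP B0; set n := Num.bound _ => hn.
have := h n; rewrite -lerBlDl => {}h.
have n0 : (0 : R) < n.+1%:R by rewrite ltr0n.
move: h; rewrite ler_pdivlMr // => h.
move: hn; rewrite ltr_pdivrMr // => hn.
have : (x - y) * n%:R < (x - y) * n.+1%:R by rewrite ltr_pM2l // ltr_nat.
have := ler_norm B.
rewrite mulrC in hn; lra.
Qed.

(* Jump from the first to the last visit to the current colour; that colour is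
   never seen again. *)
Lemma chain_bound (R : realType) (K : finType) (n : nat) (x : nat -> R)
    (col : nat -> K) (eps eta : R) :
  0 <= eps -> 0 <= eta ->
  (forall i j, (i <= j <= n)%N -> col i = col j -> `|x j - x i| <= eps) ->
  (forall i, (i < n)%N -> `|x i.+1 - x i| <= eta) ->
  `|x n - x 0%N| <= #|K|%:R * (eps + eta).
Proof.
move=> eps0 eta0 same step.
suff H (A : {set K}) : forall i, (i <= n)%N ->
    (forall j, (i <= j <= n)%N -> col j \in A) ->
    `|x n - x i| <= #|A|%:R * (eps + eta).
  by rewrite -cardsT; apply: H.
move: {2}#|A| (leqnn #|A|) => m.
elim: m A => [|m IH] A.
  rewrite leqn0 cards_eq0 => /eqP -> i le_in /(_ i).
  by rewrite leqnn le_in inE => /(_ isT).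
move=> cA i le_in inA.
have ciA : col i \in A by apply: inA; rewrite leqnn.
have exP : exists j, (i <= j <= n)%N && (col j == col i).
  by exists i; rewrite leqnn le_in eqxx.
have bP j : (i <= j <= n)%N && (col j == col i) -> (j <= n)%N.
  by case/andP => /andP[].
case: (ex_maxnP exP bP) => j /andP[/andP[ij jn] /eqP cj] jmax.
have dji : `|x j - x i| <= eps by apply: same; rewrite ?ij.
have cA1 : #|A| = (#|A :\ col i|).+1 by rewrite (cardsD1 (col i)) ciA.
move: jn; rewrite leq_eqVlt => /predU1P[jn|jn].
  have c0 : (0 : R) <= #|A :\ col i|%:R by rewrite ler0n.
  rewrite cA1 -natr1 -jn; nra.
have d1 := step _ jn.
have le2 : `|x n - x j.+1| <= #|A :\ col i|%:R * (eps + eta).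
  apply: IH => // [|k /andP[jk kn]]; first by rewrite -ltnS -cA1.
  have ik : (i <= k)%N by rewrite (leq_trans ij) // (leq_trans (leqnSn _)).
  rewrite !inE inA ?ik ?kn // andbT; apply: contraTN jk => ck.
  by rewrite -ltnNge ltnS jmax // ik kn ck.
rewrite cA1 -natr1.
have -> : x n - x i = (x n - x j.+1) + ((x j.+1 - x j) + (x j - x i)) by lra.
apply: (le_trans (ler_normD _ _)).
have := ler_normD (x j.+1 - x j) (x j - x i); lra.
Qed.

Lemma upper_envelope (R : realType) (D : finType) (d0 : D) (a s : D -> R) :
  exists act : R -> D, forall t d, a d + s d * t <= a (act t) + s (act t) * t.
Proof.
suff /boolp.choice[f hf] : forall t : R, exists x, forall d,
    a d + s d * t <= a x + s x * t by exists f.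
by move=> t; apply: (finite_argmax d0 (fun d => a d + s d * t)).
Qed.

Lemma envelope_lipschitz (R : realType) (D : finType) (a s : D -> R) act (B t t' : R) :
  (forall t d, a d + s d * t <= a (act t) + s (act t) * t) ->
  (forall d, `|s d| <= B) ->
  `|a (act t) + s (act t) * t - (a (act t') + s (act t') * t')| <= B * `|t - t'|.
Proof.
move=> hact sB.
have P u v : a (act u) + s (act u) * u - (a (act v) + s (act v) * v) <= B * `|u - v|.
  have h1 := hact v (act u).
  have h2 : s (act u) * (u - v) <= B * `|u - v|.
    by rewrite (le_trans (ler_norm _)) // normrM ler_wpM2r.
  lra.
rewrite ler_norml; have := P t t'; have := P t' t; rewrite distrC; lra.
Qed.

(* If [d] is active at both ends of an interval, a policy that is
   delta-optimal at the midpoint has almost the slope of [d]. *)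
Lemma midpoint_slope (R : realType) (a s a' s' p q delta : R) :
  a' + s' * p <= a + s * p -> a' + s' * q <= a + s * q ->
  a + s * ((p + q) / 2) - delta <= a' + s' * ((p + q) / 2) ->
  `|(s - s') * (q - p)| <= 2 * delta.
Proof. by move=> h1 h2 h3; rewrite ler_norml; lra. Qed.

(** Let psi be the difference of the two envelopes. If the same pair of lines is active at both ends
    of an interval, the policy at its midpoint has one average slope, which [midpoint_slope]
    compares with both active slopes; so psi changes by at most 4 delta. [chain_bound] then counts
    pairs of lines instead of intervals. *)
Lemma common_policy_envelope (R : realType) (D : finType) (a a' s : D -> R)
    (delta : R) (pi : R -> dist R D) (d0 d1 : D) :
  (forall t d, 0 <= t <= 1 ->
     a d + s d * t - delta <= \sum_e pi t e * (a e + s e * t)) ->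
  (forall t d, 0 <= t <= 1 ->
     a' d + s d * t - delta <= \sum_e pi t e * (a' e + s e * t)) ->
  (forall d, a d <= a d0) -> (forall d, a' d <= a' d0) ->
  (forall d, a d + s d <= a d1 + s d1) ->
  (forall d, a' d + s d <= a' d1 + s d1) ->
  `|(a d1 - a d0) - (a' d1 - a' d0)| <= #|{: D * D}|%:R * (4 * delta).
Proof.
move=> opt opt' at0 at0' at1 at1'.
have delta0 : 0 <= delta.
  have [x hx] := finite_argmax d0 a.
  have := opt 0 x; rewrite lexx ler01 => /(_ isT).
  have : \sum_e pi 0 e * (a e + s e * 0) <= \sum_e pi 0 e * a x.
    apply: ler_sum => e _; rewrite mulr0 addr0 ler_wpM2l ?mass_ge0 //.
  rewrite -mulr_suml mass_sum1 mul1r mulr0; lra.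
have [act hact] := upper_envelope d0 a s.
have [act' hact'] := upper_envelope d0 a' s.
have [x hx] := finite_argmax d0 (fun d => `|s d|).
pose psi t := (a (act t) + s (act t) * t) - (a' (act' t) + s (act' t) * t).
have psi0 : psi 0 = a d0 - a' d0.
  have h1 := hact 0 d0; have h2 := at0 (act 0).
  have h3 := hact' 0 d0; have h4 := at0' (act' 0).
  rewrite /psi; lra.
have psi1 : psi 1 = a d1 - a' d1.
  have h1 := hact 1 d1; have h2 := at1 (act 1).
  have h3 := hact' 1 d1; have h4 := at1' (act' 1).
  rewrite /psi; lra.
have avg b t : \sum_e pi t e * (b e + s e * t) =
    (\sum_e pi t e * b e) + (\sum_e pi t e * s e) * t.
  by rewrite mulr_suml -big_split; apply: eq_bigr => e _; rewrite mulrDr mulrA.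
have le_act b act0 (t u : R) :
    (forall t d, b d + s d * t <= b (act0 t) + s (act0 t) * t) ->
    (\sum_e pi t e * b e) + (\sum_e pi t e * s e) * u <=
    b (act0 u) + s (act0 u) * u.
  move=> h; rewrite mulr_suml -big_split /=.
  have -> : b (act0 u) + s (act0 u) * u =
      \sum_e pi t e * (b (act0 u) + s (act0 u) * u).
    by rewrite -mulr_suml mass_sum1 mul1r.
  by apply: ler_sum => e _; rewrite -mulrA -mulrDr ler_wpM2l ?mass_ge0.
have samecol p q : 0 <= p <= 1 -> 0 <= q <= 1 -> act p = act q ->
    act' p = act' q -> `|psi q - psi p| <= 4 * delta.
  move=> hp hq e1 e2; rewrite /psi -e1 -e2.
  set m := (p + q) / 2.
  have hm : 0 <= m <= 1 by rewrite /m; lra.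
  have h1 := midpoint_slope (le_act a act m p hact).
  have := le_act a act m q hact; rewrite -e1 => /h1 {}h1.
  have := opt m (act p) hm; rewrite avg => /h1 {}h1.
  have h2 := midpoint_slope (le_act a' act' m p hact').
  have := le_act a' act' m q hact'; rewrite -e2 => /h2 {}h2.
  have := opt' m (act' p) hm; rewrite avg => /h2 {}h2.
  move: h1 h2; rewrite !ler_norml; lra.
have -> : a d1 - a d0 - (a' d1 - a' d0) = psi 1 - psi 0 by rewrite psi0 psi1; lra.
set B := `|s x|.
(* The grid on [0, 1] is refined without limit: a single step costs at most 2B/(n+1) for each pair
   of lines, and [ler_archi] removes this term. *)
apply: (@ler_archi _ _ _ (#|{: D * D}|%:R * (2 * B))) => n.
have n0 : (0 : R) < n.+1%:R by rewrite ltr0n.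
pose t k : R := k%:R / n.+1%:R.
have t01 k : (k <= n.+1)%N -> 0 <= t k <= 1.
  by move=> kn; rewrite /t divr_ge0 ?ler0n //= ler_pdivrMr // mul1r ler_nat.
have t0E : t 0%N = 0 by rewrite /t mul0r.
have tnE : t n.+1 = 1 by rewrite /t divff // gt_eqF.
have -> : #|{: D * D}|%:R * (4 * delta) + #|{: D * D}|%:R * (2 * B) / n.+1%:R =
    #|{: D * D}|%:R * (4 * delta + 2 * B / n.+1%:R) by rewrite mulrDr !mulrA.
have -> : psi 1 - psi 0 = psi (t n.+1) - psi (t 0%N) by rewrite tnE t0E.
apply: (@chain_bound _ _ _ (psi \o t) (fun k => (act (t k), act' (t k)))) => /=.
- lra.
- by rewrite divr_ge0 // mulr_ge0 // normr_ge0.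
- move=> i j /andP[ij jn] [e1 e2]; apply: samecol => //; apply: t01 => //.
  exact: leq_trans ij jn.
- move=> i _.
  have E : t i.+1 - t i = n.+1%:R^-1 by rewrite /t -mulrBl -natr1 addrC addKr mul1r.
  have := @envelope_lipschitz _ _ a s act B (t i.+1) (t i) hact hx.
  have := @envelope_lipschitz _ _ a' s act' B (t i.+1) (t i) hact' hx.
  rewrite E (gtr0_norm (_ : 0 < n.+1%:R^-1)) ?invr_gt0 // /psi !ler_norml -mulrA.
  move: (B / n.+1%:R) (s _ * t i) (s _ * t i.+1) (s _ * t i) (s _ * t i.+1).
  move=> b x1 x2 x3 x4; lra.
Qed.

(** * Null sets *)

Lemma sum_onth_le (R : realType) (J : Type) (vol : J -> R) (e : seq J) n :
  (forall j, 0 <= vol j) ->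
  \sum_(k < n) oapp vol 0 (onth e k) <= \sum_(j <- e) vol j.
Proof.
move=> vol0; elim: e n => [|j e IH] [|n].
- by rewrite big_ord0 big_nil.
- by rewrite big_nil big1 // => k _; case: k => -[].
- by rewrite big_ord0 big_cons addr_ge0 // sumr_ge0.
- by rewrite big_ord_recl big_cons lerD2l IH.
Qed.

Lemma lebesgue_null_finite_cover (R : realType) (I : finType) (i0 : I)
    (N : (I -> R) -> Prop) :
  (forall eps : R, 0 < eps ->
   exists (J : finType) (a b : J -> I -> R),
   [/\ forall j i, a j i <= b j i,
       forall x, N x -> exists j, forall i, a j i <= x i <= b j i
     & \sum_j \prod_i (b j i - a j i) <= eps]) ->
  lebesgue_null N.
Proof.
move=> H eps /H[J [a [b [ab cov vol]]]].
(* Beyond the enumeration of J the boxes shrink to the point 0; the coordinate [i0] gives them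
   volume 0 rather than the empty product 1. *)
pose ext (c : J -> I -> R) k i := oapp (c^~ i) 0 (onth (enum J) k).
exists (ext a), (ext b); split.
- by move=> k i; rewrite /ext; case: onth => [j|] /=.
- move=> x /cov[j hj].
  have /onthP[k hk] : j \in enum J by rewrite mem_enum.
  by exists k => i; rewrite /ext hk; apply: hj.
- move=> n; apply: le_trans vol.
  have vol0 j : 0 <= \prod_i (b j i - a j i).
    by rewrite prodr_ge0 // => i _; rewrite subr_ge0.
  have := sum_onth_le (enum J) n vol0.
  rewrite big_enum /=; apply: le_trans.
  apply: ler_sum => k _; rewrite /ext; case: onth => //=.
  by rewrite (bigD1 i0) //= subrr mul0r.
Qed.

Lemma grid_cell (R : realType) (n : nat) (x : R) : 0 <= x <= 1 ->
  exists z : 'I_n.+1, z%:R / n.+1%:R <= x <= z%:R / n.+1%:R + n.+1%:R^-1.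
Proof.
case/andP=> x0 x1; have n0 : (0 : R) < n.+1%:R by rewrite ltr0n.
have xn0 : 0 <= x * n.+1%:R by rewrite mulr_ge0 // ltW.
have /andP[t1 t2] := truncn_itv xn0.
set m := Num.trunc _ in t1 t2.
case: (ltnP m n.+1) => mn.
  exists (Ordinal mn) => /=.
  rewrite ler_pdivrMr // t1 /= -[X in _ + X]mul1r -mulrDl ler_pdivlMr //.
  by rewrite natr1 ltW.
(* Only x = 1 truncates to n + 1; it is the right end of the last cell. *)
have xn : x = 1.
  apply/eqP; rewrite eq_le x1 -(ler_pM2r n0) mul1r (le_trans _ t1) //.
  by rewrite ler_nat.
exists ord_max => /=; rewrite xn ler_pdivrMr // mul1r ler_nat leqnSn /=.
by rewrite -[X in _ + X]mul1r -mulrDl natr1 divff // gt_eqF.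
Qed.

(** One equation covers both coincidences to be excluded: k2 = k3 = k4 says that two parameters are
    equal, and distinct indices express a vanishing second difference. Since k1 differs from the
    others, the equation determines t k1 from the remaining coordinates. *)
Definition degenerate (R : realType) (I : finType) (t : I -> R) : Prop :=
  (forall k, 0 <= t k <= 1) /\
  exists k1 k2 k3 k4 : I,
    [/\ k2 != k1, k3 != k1, k4 != k1 & t k1 = t k2 + t k3 - t k4].

(** Each solution set is the graph of t k1 as a function of the other coordinates. Over a grid cell
    of side w it varies by at most 3w, so one box of that height covers it, and the boxes of one
    quadruple have total volume 3w. *)
Lemma degenerate_null (R : realType) (I : finType) (i0 : I) :
  lebesgue_null (@degenerate R I).
Proof.
apply: (lebesgue_null_finite_cover i0) => eps eps0.
pose q := #|{: (I * I) * (I * I)}|.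
have B0 : 0 <= q%:R * 3 / eps by rewrite divr_ge0 ?mulr_ge0 // ltW.
have := archi_boundP B0; set n := Num.bound _ => hn.
have n0 : (0 : R) < n.+1%:R by rewrite ltr0n.
have step0 : (0 : R) < n.+1%:R^-1 by rewrite invr_gt0.
set w : R := n.+1%:R^-1 in step0 *.
have qw : q%:R * (3 * w) <= eps.
  rewrite mulrA ler_pdivrMr // [leRHS]mulrC -ler_pdivrMr // (le_trans (ltW hn)) //.
  by rewrite ler_nat.
pose ctr (k : (I * I) * (I * I)) (z : {ffun I -> 'I_n.+1}) : R :=
  (z k.1.2)%:R * w + (z k.2.1)%:R * w - (z k.2.2)%:R * w.
(* A cell fixes every coordinate but k1 up to 1/(n+1); the slot z k1 is unused,
   so the box is kept for z k1 = 0 only and made degenerate otherwise. *)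
pose J : finType := (((I * I) * (I * I)) * {ffun I -> 'I_n.+1})%type.
exists J, (fun (j : J) i => if i == j.1.1.1 then ctr j.1 j.2 - w else (j.2 i)%:R * w),
  (fun (j : J) i =>
  if i == j.1.1.1 then
    if j.2 i == ord0 then ctr j.1 j.2 + 2 * w else ctr j.1 j.2 - w
  else (j.2 i)%:R * w + w).
split.
- move=> j i; case: (i == _); last by lra.
  by case: (_ == ord0); lra.
- move=> x [x01 [k1 [k2 [k3 [k4 [k21 k31 k41 xE]]]]]].
  have /boolp.choice[z hz] : forall k, exists z : 'I_n.+1,
    z%:R * w <= x k <= z%:R * w + w by move=> k; apply: grid_cell.
  pose z' : {ffun I -> 'I_n.+1} := [ffun k => if k == k1 then ord0 else z k].
  exists (((k1, k2), (k3, k4)), z') => i /=.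
  case: ifP => ik1; last by rewrite ffunE ik1.
  rewrite (eqP ik1) /ctr /= !ffunE !eqxx (negbTE k21) (negbTE k31) (negbTE k41) xE.
  have := hz k2; have := hz k3; have := hz k4; lra.
- pose h (k : (I * I) * (I * I)) (i : I) (c : 'I_n.+1) : R :=
    if i == k.1.1 then (if c == ord0 then 3 * w else 0) else w.
  rewrite (eq_bigr (fun j : J => \prod_i h j.1 i (j.2 i))); last first.
    move=> j _; apply: eq_bigr => i _; rewrite /h.
    case: (i == _); last by lra.
    by case: (_ == ord0); lra.
  rewrite -(pair_bigA _ (fun k (z : {ffun I -> 'I_n.+1}) => \prod_i h k i (z i))) /=.
  rewrite (eq_bigr (fun=> 3 * w)).
    by rewrite sumr_const -[leLHS]mulr_natl; exact: qw.
  (* The sum over all cells factors into one sum per coordinate: 3w at k1 and (n+1)w = 1 at every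
     other one. *)
  move=> k _; rewrite -bigA_distr_bigA (bigD1 k.1.1) //= [X in _ * X]big1.
    rewrite mulr1 (bigD1 ord0) //= /h !eqxx big1 ?addr0 // => c /negbTE c0.
    by rewrite c0.
  move=> i /negbTE ik; rewrite /h ik sumr_const card_ord -mulr_natl.
  by rewrite divff // gt_eqF.
Qed.

(** * Expectations under local interventions *)

Section Interventions.
Variables (C : finType) (dom : option C -> finType) (R : realType).

Local Notation asg := (assignment dom).

Definition upd (v : asg) (w : option C) (x : dom w) : asg :=
  [ffun j => dfwith v x j].

Lemma upd_in v w (x : dom w) : upd v x w = x.
Proof. by rewrite ffunE dfwith_in. Qed.

Lemma upd_out v w (x : dom w) j : w != j -> upd v x j = v j.
Proof. by move=> wj; rewrite ffunE dfwith_out. Qed.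

Lemma upd_upd v w (x y : dom w) : upd (upd v x) y = upd v y.
Proof.
apply/ffunP => j; have [<-|wj] := eqVneq w j; first by rewrite !upd_in.
by rewrite !upd_out.
Qed.

Lemma upd_id v w : upd v (v w) = v.
Proof.
apply/ffunP => j; have [<-|wj] := eqVneq w j; first by rewrite upd_in.
by rewrite upd_out.
Qed.

Lemma updC v w w' (x : dom w) (y : dom w') : w != w' ->
  upd (upd v x) y = upd (upd v y) x.
Proof.
move=> ww'; apply/ffunP => j; have [<-|wj] := eqVneq w j.
  by rewrite upd_in upd_out 1?eq_sym // upd_in.
have [<-|w'j] := eqVneq w' j; first by rewrite upd_in upd_out // upd_in.
by rewrite !upd_out.
Qed.

Lemma restrictP (S : {set option C}) (v v' : asg) :
  reflect (forall w, w \in S -> v w = v' w) (restrict S v == restrict S v').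
Proof.
apply: (iffP eqP) => [/ffunP E w wS|E].
  by have := E (exist _ w wS); rewrite !ffunE.
by apply/ffunP => -[w wS]; rewrite !ffunE E.
Qed.

Lemma restrict_upd (S : {set option C}) v w (x : dom w) :
  w \notin S -> restrict S (upd v x) = restrict S v.
Proof.
move=> wS; apply/eqP/restrictP => j jS; rewrite upd_out //.
by apply: contraNneq wS => ->.
Qed.

Definition soft := {dffun forall i : C, {ffun dom (Some i) -> dom (Some i)}}.

Definition intervene (f : soft) i (h : {ffun dom (Some i) -> dom (Some i)}) : soft :=
  [ffun j => dfwith f h j].

Lemma intervene_in f i (h : {ffun dom (Some i) -> dom (Some i)}) :
  intervene f h i = h.
Proof. by rewrite ffunE dfwith_in. Qed.

Lemma intervene_out f i (h : {ffun dom (Some i) -> dom (Some i)}) j :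
  i != j -> intervene f h j = f j.
Proof. by move=> ij; rewrite ffunE dfwith_out. Qed.

Section Env.
Variables (G : diagram C) (P : environment dom R G).
Arguments P : clear implicits.

Definition kernel (f : soft) i (v : asg) : R :=
  \sum_(x | f i x == v (Some i)) P i (restrict _ v) x.

(* The decision has no factor here: ev sums over all its states. *)
Definition ev (f : soft) (phi : asg -> R) : R :=
  \sum_v (\prod_i kernel f i v) * phi v.

Lemma kernel_ge0 f i v : 0 <= kernel f i v.
Proof. by apply: sumr_ge0 => x _; apply: mass_ge0. Qed.

Lemma kernel_le1 f i v : kernel f i v <= 1.
Proof.
rewrite -(mass_sum1 (P i (restrict _ v))) /kernel big_mkcond /=.
by apply: ler_sum => x _; case: ifP => // _; apply: mass_ge0.
Qed.

Lemma kernel_const (f : soft) i v y : f i = [ffun=> y] ->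
  kernel f i v = (y == v (Some i))%:R.
Proof.
move=> E; rewrite /kernel E; case: eqP => [<-|ne].
  by rewrite (eq_bigl xpredT) ?mass_sum1 // => x; rewrite ffunE eqxx.
by rewrite big_pred0 // => x; rewrite ffunE; apply/eqP.
Qed.

Lemma evB f phi psi : ev f (fun v => phi v - psi v) = ev f phi - ev f psi.
Proof. by rewrite /ev -sumrB; apply: eq_bigr => v _; rewrite mulrBr. Qed.

Lemma ev_ge0 f phi : (forall v, 0 <= phi v) -> 0 <= ev f phi.
Proof.
move=> phi0; apply: sumr_ge0 => v _; rewrite mulr_ge0 // prodr_ge0 // => i _.
exact: kernel_ge0.
Qed.

Lemma ev_le_card f phi : (forall v, 0 <= phi v <= 1) -> ev f phi <= #|{: asg}|%:R.
Proof.
move=> phi01; rewrite -sum1_card natr_sum; apply: ler_sum => v _.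
have /andP[p0 p1] := phi01 v.
rewrite -[leRHS]mulr1 ler_pM // ?prodr_ge0 // => [i _|]; first exact: kernel_ge0.
by apply: prodr_ile1 => i _; rewrite kernel_ge0 kernel_le1.
Qed.

(** The parents of i are held at v, so C_i is drawn from one fixed row of its table, and drawing x
    amounts to a random hard intervention with value h x. *)
Lemma ev_one_step (f : soft) i (h : {ffun dom (Some i) -> dom (Some i)}) (v : asg) phi :
  None \notin Pa G (chance i) ->
  (forall j, Some j \in Pa G (chance i) -> j != i /\ f j = [ffun=> v (Some j)]) ->
  ev (intervene f h) phi =
  \sum_x P i (restrict _ v) x * ev (intervene f [ffun=> h x]) phi.
Proof.
move=> NPa Paf; under [RHS]eq_bigr do rewrite mulr_sumr.
rewrite exchange_big; apply: eq_bigr => c _ /=.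
rewrite (bigD1 i) //=.
set Q := \prod_(j | j != i) _.
have QE x : \prod_j kernel (intervene f [ffun=> h x]) j c =
    (h x == c (Some i))%:R * Q.
  rewrite (bigD1 i) //= (kernel_const _ (intervene_in _ _)).
  congr (_ * _); apply: eq_bigr => j ji.
  by rewrite /kernel !intervene_out // eq_sym.
under eq_bigr do rewrite QE.
rewrite -mulrA.
have [E|/restrictP E] := eqVneq (restrict (Pa G (chance i)) c) (restrict _ v).
  rewrite /kernel intervene_in E mulr_suml [LHS]big_mkcond; apply: eq_bigr => x _.
  by case: (_ == _); rewrite ?mul1r ?mul0r ?mulr0 ?mulrA.
(* Where c and v differ at a parent of i, the constant map at that parent contributes a zero factor,
   and both sides vanish. *)
suff -> : Q = 0.
  by rewrite mul0r mulr0 big1 // => x _; rewrite mulr0 mul0r mulr0.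
have [j jPa cj] : exists2 j, Some j \in Pa G (chance i) & c (Some j) <> v (Some j).
  apply: boolp.contrapT => H; apply: E => -[j|] jPa; last by rewrite jPa in NPa.
  by apply: boolp.contrapT => cj; apply: H; exists j.
have [ji fj] := Paf j jPa.
rewrite /Q (bigD1 j) //= (@kernel_const _ _ _ (v (Some j))).
  by rewrite (negbTE (introN eqP (not_eq_sym cj))) mul0r.
by rewrite intervene_out // eq_sym.
Qed.

Lemma ev_hard (v : asg) phi :
  ev [ffun i => [ffun=> v (Some i)]] phi = \sum_d phi (upd v (w := None) d).
Proof.
rewrite /ev (bigID (fun c : asg => [forall i, c (Some i) == v (Some i)])) /=.
rewrite [X in _ + X]big1 ?addr0; last first.
  move=> c /forallPn[i /negbTE ne]; rewrite (bigD1 i) //=.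
  by rewrite (@kernel_const _ _ _ (v (Some i))) ?ffunE // eq_sym ne !mul0r.
rewrite (reindex_onto (fun d => upd v (w := None) d) (fun c => c None)) /=.
  apply: eq_big => [d|d _].
    rewrite upd_in eqxx andbT; apply/forallP => i.
    by rewrite upd_out.
  rewrite big1 ?mul1r // => i _.
  by rewrite (@kernel_const _ _ _ (v (Some i))) ?upd_out ?eqxx // ffunE.
move=> c /forallP H; apply/ffunP => -[i|]; last by rewrite upd_in.
by rewrite upd_out // (eqP (H i)).
Qed.

End Env.
End Interventions.

(** * Regret at one observation *)

Section Observations.
Variables (C : finType) (dom : option C -> finType) (R : realType).

Local Notation asg := (assignment dom).

Lemma point_mass (T : finType) (x : T) : exists p : dist R T, forall y, p y = (y == x)%:R.
Proof.
have ge0 y : 0 <= [ffun y : T => (y == x)%:R : R] y by rewrite ffunE ler0n.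
have sum1 : \sum_y [ffun y : T => (y == x)%:R : R] y = 1.
  rewrite (bigD1 x) //= ffunE eqxx big1 ?addr0 // => y /negbTE yx.
  by rewrite ffunE yx.
by exists (Dist ge0 sum1) => y; rewrite ffunE.
Qed.

Lemma dist_le1 (T : finType) (q : dist R T) x : q x <= 1.
Proof.
by rewrite -(mass_sum1 q) (bigD1 x) //= lerDl sumr_ge0 // => y _; apply: mass_ge0.
Qed.

(** The points may coincide, so the mass is described by its support and its expectations and not by
    its values. *)
Lemma three_point_mass (T : finType) (x y z : T) (l t : R) :
  0 <= l <= 1 -> 0 <= t <= 1 ->
  exists2 p : dist R T, forall w, p w != 0 -> w \in [:: x; y; z] &
  forall F : T -> R,
    \sum_w p w * F w = l * F x + (1 - l) * (t * F y + (1 - t) * F z).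
Proof.
move=> /andP[l0 l1] /andP[t0 t1].
have [[[px hx] [py hy]] [pz hz]] := (point_mass x, point_mass y, point_mass z).
pose q := [ffun w => l * px w + (1 - l) * (t * py w + (1 - t) * pz w)].
have sumE p (a : T) : (forall w, p w = (w == a)%:R) ->
    forall F : T -> R, \sum_w p w * F w = F a.
  move=> hp F; rewrite (bigD1 a) //= hp eqxx mul1r big1 ?addr0 // => w /negbTE wa.
  by rewrite hp wa mul0r.
have sumqE (F : T -> R) :
    \sum_w q w * F w = l * F x + (1 - l) * (t * F y + (1 - t) * F z).
  rewrite -(sumE _ _ hx F) -(sumE _ _ hy F) -(sumE _ _ hz F) !mulr_sumr.
  rewrite -big_split /= mulr_sumr -big_split; apply: eq_bigr => w _.
  by rewrite ffunE /=; ring.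
have ge0 w : 0 <= q w.
  rewrite ffunE addr_ge0 ?mulr_ge0 ?mass_ge0 ?subr_ge0 //.
  by rewrite addr_ge0 ?mulr_ge0 ?mass_ge0 ?subr_ge0.
have sum1 : \sum_w q w = 1.
  by under eq_bigr do rewrite -[q _]mulr1; rewrite sumqE; ring.
exists (Dist ge0 sum1); last exact: sumqE.
move=> w; apply: contraNT; rewrite !inE !negb_or.
case/and3P=> wx wy wz /=.
by rewrite ffunE hx hy hz (negbTE wx) (negbTE wy) (negbTE wz) !mulr0 addr0 mulr0 addr0.
Qed.

Definition payoff (G : diagram C) (M : cid dom R G) (v : asg) : R :=
  util M (restrict _ v).

(** The value of d upon the observation o, not divided by the probability of o; observations of
    probability zero need no separate case. *)
Definition observed (S : {set option C}) (o : asg) (u : asg -> R) (d : dom None)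
    (v : asg) : R :=
  (restrict S v == restrict S o)%:R * (v None == d)%:R * u v.

Lemma ev_hard_observed (G : diagram C) (P : environment dom R G)
    (S : {set option C}) (o : asg) u d (c : asg) :
  None \notin S ->
  ev P [ffun i => [ffun=> c (Some i)]] (observed S o u d) =
  (restrict S c == restrict S o)%:R * u (upd c d).
Proof.
move=> NS; rewrite ev_hard (bigD1 d) //= big1 => [|e /negbTE ed].
  by rewrite addr0 /observed upd_in eqxx restrict_upd // mulr1.
by rewrite /observed upd_in ed mulr0 mul0r.
Qed.

Section Regret.
Variables (G : diagram C) (M : cid dom R G).
Local Notation P := (cpt M).
Local Notation u := (payoff M).

Lemma sum_ev (p : mixture dom R) (phi : asg -> R) :
  \sum_s p s * ev P s.1 phi =
  \sum_v (\sum_s p s * \prod_i kernel P s.1 i v) * phi v.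
Proof.
under eq_bigr do rewrite mulr_sumr.
rewrite exchange_big; apply: eq_bigr => v _; rewrite mulr_suml.
by apply: eq_bigr => s _; rewrite mulrA.
Qed.

Lemma EU_mix_common_mask (p : mixture dom R) (m : {set option C}) (pi : policy dom R) :
  (forall s, p s != 0 -> s.2 = m) ->
  EU_mix (util M) P p pi =
  \sum_v (\sum_s p s * \prod_i kernel P s.1 i v) *
    (pi _ (restrict (Pa G (decision C) :\: m) v) (v None) * u v).
Proof.
move=> pm; apply: eq_bigr => v _; rewrite mulrA; congr (_ * _).
rewrite mulr_suml; apply: eq_bigr => s _.
have [->|/pm sm] := eqVneq (p s) 0; first by rewrite !mul0r.
by rewrite /joint sm -mulrA.
Qed.

(* Switching to [d] upon the observation [o] alone gains at most delta. *)
Lemma regret_observed (p : mixture dom R) (m : {set option C}) delta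
    (pi : policy dom R) (o : asg) (d : dom None) :
  let S := Pa G (decision C) :\: m in
  (forall s, p s != 0 -> s.2 = m) ->
  regret_le (EU_mix (util M) P p) delta pi ->
  \sum_s p s * ev P s.1 (observed S o u d) - delta <=
  \sum_e pi S (restrict S o) e * (\sum_s p s * ev P s.1 (observed S o u e)).
Proof.
move=> S pm [pio opt reg].
have [q hq] := point_mass d.
pose pi' : policy dom R := fun T c => if c == restrict T o then q else pi T c.
have := opt pi'; move: reg; rewrite !(EU_mix_common_mask _ pm) -/S.
set A := fun v : asg => \sum_s p s * \prod_i kernel P s.1 i v.
under [X in _ -> _ -> _ - _ <= X]eq_bigr do rewrite sum_ev mulr_sumr.
rewrite sum_ev -/A exchange_big /=.
have obsE v : \sum_e pi S (restrict S o) e * (A v * observed S o u e v) =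
    A v * ((restrict S v == restrict S o)%:R * (pi S (restrict S o) (v None) * u v)).
  rewrite (bigD1 (v None)) //= big1 => [|e /negbTE ne]; last first.
    by rewrite /observed [v None == e]eq_sym ne mulr0 mul0r !mulr0.
  by rewrite addr0 /observed eqxx mulr1; ring.
under [X in _ -> _ -> _ - _ <= X]eq_bigr do rewrite obsE.
set X := \sum_v _; set Y := \sum_v _; set Z := \sum_v _; set W := \sum_v _.
set V := \sum_v _.
(* [pi'] and [pi] differ only at the observation o, so their expected utilities differ by the terms
   at o alone. *)
suff : Z - Y = W - V by lra.
rewrite /Z /Y /W /V -!sumrB; apply: eq_bigr => v _.
rewrite /pi' /observed -/(A v).
have [->|ne] := eqVneq (restrict S v) (restrict S o).
  by rewrite hq !mul1r.
by rewrite !mul0r !mulr0 !subrr.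
Qed.

End Regret.

(** Both c1 and c2 produce the observation o with certainty, so at o the slopes in t consist of
    payoffs, which the two models share, and the value under f enters the intercepts with weight l.
    The factor (B + eta) / eta is the inverse of l. *)
Lemma contrast_identified (G G' : diagram C) (M : cid dom R G) (M' : cid dom R G')
    (m : {set option C}) (o c1 c2 : asg) (d1 d2 : dom None) (eta delta : R)
    (pi : mixture dom R -> policy dom R) :
  let S := Pa G (decision C) :\: m in
  let u := payoff M in
  let B := #|{: asg}|%:R in
  Pa G' (decision C) = Pa G (decision C) -> payoff M' =1 u ->
  None \notin S -> 0 < eta ->
  restrict S c1 = restrict S o -> restrict S c2 = restrict S o ->
  (forall d, d != d1 -> u (upd c1 d) + eta <= u (upd c1 d1)) ->
  (forall d, d != d2 -> u (upd c2 d) + eta <= u (upd c2 d2)) ->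
  (forall s, regret_le (EU_mix (util M) (cpt M) s) delta (pi s)) ->
  (forall s, regret_le (EU_mix (util M') (cpt M') s) delta (pi s)) ->
  forall f : soft dom,
  `|ev (cpt M) f (fun v => observed S o u d1 v - observed S o u d2 v) -
    ev (cpt M') f (fun v => observed S o u d1 v - observed S o u d2 v)|
  <= (B + eta) / eta * (#|{: dom None * dom None}|%:R * 4) * delta.
Proof.
move=> S u B EPa Eu NS eta0 E1 E2 gap1 gap2 reg reg' f.
have B0 : 0 <= B by rewrite ler0n.
(* With this weight l B = (1 - l) eta, so the term of f, which varies by at most l B, cannot
   overturn the gap eta: d2 is active at t = 0 and d1 at t = 1, in both models. *)
pose l := eta / (B + eta).
have Be0 : 0 < B + eta by lra.
have l0 : 0 < l by rewrite divr_gt0.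
have lE : l * B = (1 - l) * eta.
  have : l * (B + eta) = eta by rewrite /l divfK // gt_eqF.
  lra.
have l01 : 0 <= l <= 1 by rewrite ltW //= ler_pdivrMr // mul1r; lra.
have u01 v : 0 <= u v <= 1 by apply: util_range.
have obs01 d v : 0 <= observed S o u d v <= 1.
  rewrite /observed; have := u01 v.
  by case: (_ == _); case: (_ == _); rewrite ?mul0r ?mulr0 ?mul1r ?mulr1 ?mul0r; lra.
pose w d := ev (cpt M) f (observed S o u d).
pose w' d := ev (cpt M') f (observed S o u d).
have w01 d : 0 <= w d <= B.
  by rewrite ev_le_card // ev_ge0 // => v; case/andP: (obs01 d v).
have w'01 d : 0 <= w' d <= B.
  by rewrite ev_le_card // ev_ge0 // => v; case/andP: (obs01 d v).
pose hard (c : asg) : local_int dom := ([ffun i => [ffun=> c (Some i)]], m).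
have obsE e : observed S o (payoff M') e =1 observed S o u e.
  by move=> v; rewrite /observed Eu.
have evE (G0 : diagram C) (P0 : environment dom R G0) f0 phi psi :
    phi =1 psi -> ev P0 f0 phi = ev P0 f0 psi.
  by move=> E; apply: eq_bigr => v _; rewrite E.
have /boolp.choice[q hq] : forall t : R, exists q : dist R (dom None),
    0 <= t <= 1 -> forall d,
    (l * w d + (1 - l) * (t * u (upd c1 d) + (1 - t) * u (upd c2 d)) - delta <=
     \sum_e q e * (l * w e + (1 - l) * (t * u (upd c1 e) + (1 - t) * u (upd c2 e)))) /\
    (l * w' d + (1 - l) * (t * u (upd c1 d) + (1 - t) * u (upd c2 d)) - delta <=
     \sum_e q e * (l * w' e + (1 - l) * (t * u (upd c1 e) + (1 - t) * u (upd c2 e)))).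
  (* Outside [0, 1] there is no mixture, and the choice of q is arbitrary. *)
  move=> t; have [t01|t01] := boolP (0 <= t <= 1); last first.
    by have [q _] := point_mass d1; exists q.
  have [p psupp pE] := @three_point_mass _ (f, m) (hard c1) (hard c2) l t l01 t01.
  have pm s : p s != 0 -> s.2 = m.
    by move/psupp; rewrite !inE => /or3P[] /eqP ->.
  exists (pi p S (restrict S o)) => _ d.
  have := @regret_observed G' M' p m delta (pi p) o d pm (reg' p).
  have := @regret_observed G M p m delta (pi p) o d pm (reg p).
  rewrite EPa -/S !pE /= !ev_hard_observed // E1 E2 eqxx !mul1r -/(w d) !Eu.
  rewrite (evE _ _ _ _ _ (obsE d)).
  rewrite -/(w' d) => r1 r2.
  split; [apply: le_trans r1 _|apply: le_trans r2 _].
    by apply: ler_sum => e _; rewrite pE /= !ev_hard_observed // E1 E2 eqxx !mul1r.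
  apply: ler_sum => e _; rewrite pE /= !ev_hard_observed // E1 E2 eqxx !mul1r !Eu.
  by rewrite (evE _ _ _ _ _ (obsE e)).
pose s (d : dom None) := (1 - l) * (u (upd c1 d) - u (upd c2 d)).
have at_end (x : dom None -> R) c e : (forall d, 0 <= x d <= B) ->
    (forall d, d != e -> u (upd c d) + eta <= u (upd c e)) ->
    forall d, l * x d + (1 - l) * u (upd c d) <= l * x e + (1 - l) * u (upd c e).
  move=> x01 gap d; have [->//|/gap g] := eqVneq d e.
  have := x01 d; have := x01 e; nra.
have lin (x : dom None -> R) t d : l * x d + (1 - l) * u (upd c2 d) + s d * t =
  l * x d + (1 - l) * (t * u (upd c1 d) + (1 - t) * u (upd c2 d)).
  by rewrite /s; lra.
have lin1 (x : dom None -> R) d : l * x d + (1 - l) * u (upd c2 d) + s d =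
  l * x d + (1 - l) * u (upd c1 d) by rewrite /s; lra.
pose a (x : dom None -> R) d := l * x d + (1 - l) * u (upd c2 d).
have env : `|(a w d1 - a w d2) - (a w' d1 - a w' d2)| <=
    #|{: dom None * dom None}|%:R * (4 * delta).
  apply: (@common_policy_envelope R (dom None) (a w) (a w') s delta q d2 d1).
  - move=> t d t01; rewrite lin.
    by under eq_bigr do rewrite lin; case: (hq t t01 d).
  - move=> t d t01; rewrite lin.
    by under eq_bigr do rewrite lin; case: (hq t t01 d).
  - exact: at_end.
  - exact: at_end.
  - by move=> d; rewrite !lin1; apply: at_end.
  - by move=> d; rewrite !lin1; apply: at_end.
rewrite !evB -/(w d1) -/(w d2) -/(w' d1) -/(w' d2).
have -> : (B + eta) / eta * (#|{: dom None * dom None}|%:R * 4) * delta =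
    l^-1 * (#|{: dom None * dom None}|%:R * (4 * delta)).
  by rewrite /l invf_div; ring.
rewrite ler_pdivlMl // -[X in X * _](gtr0_norm l0) -normrM.
by rewrite (_ : l * _ = a w d1 - a w d2 - (a w' d1 - a w' d2)) // /a; ring.
Qed.

End Observations.

(** * Chordless paths *)

Section Paths.
Variables (C : finType) (dom : option C -> finType) (R : realType).
Variables (r : assignment dom) (n : forall i : C, dom (Some i)).

Local Notation asg := (assignment dom).

Lemma path_no_return (G : diagram C) (x : node C) p y :
  path G x p -> y \in p -> ~~ G y x.
Proof.
case: p => // z p /= /andP[xz zp] yp; apply: contraNN (diagram_acyclic G x) => yx.
apply/existsP; exists z; rewrite xz.
exact: connect_trans (path_connect zp yp) (connect1 yx).
Qed.

Lemma path_not_mem (G : diagram C) (x : node C) p : path G x p -> x \notin p.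
Proof.
case: p => // z p /= /andP[xz zp]; apply: contraNN (diagram_acyclic G x) => xp.
by apply/existsP; exists z; rewrite xz (path_connect zp xp).
Qed.

Definition binary (i : C) (x : dom (Some i)) : {ffun dom (Some i) -> dom (Some i)} :=
  [ffun y => if y == x then n i else r (Some i)].

(* The variables of [p] keep their mechanism, up to a binary coarsening; all
   other chance variables are held at [v]. *)
Definition released (p : seq C) (v : asg) : soft dom :=
  [ffun i => if i \in p then binary (n i) else [ffun=> v (Some i)]].

Lemma intervene_binary p v i : i \notin p ->
  intervene (released p v) (binary (n i)) = released (i :: p) v.
Proof.
move=> ip; apply/ffunP => j; have [<-|ij] := eqVneq i j.
  by rewrite intervene_in ffunE mem_head.
by rewrite intervene_out // !ffunE inE eq_sym (negbTE ij).
Qed.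

Lemma intervene_hard p v i y : i \notin p ->
  intervene (released p v) [ffun=> y] = released p (upd v (w := Some i) y).
Proof.
move=> ip; apply/ffunP => j; have [<-|ij] := eqVneq i j.
  by rewrite intervene_in [RHS]ffunE (negbTE ip) upd_in.
rewrite intervene_out // [LHS]ffunE [RHS]ffunE; case: ifP => // _.
by apply/ffunP => x; rewrite [LHS]ffunE [RHS]ffunE upd_out.
Qed.

Section Contrast.
Variable phi : asg -> R.

Definition response (G : diagram C) (P : environment dom R G) p v : R :=
  ev P (released p v) phi.

Definition effect (G : diagram C) (P : environment dom R G) p i v : R :=
  response P p (upd v (n i)) - response P p (upd v (r (Some i))).

(** The released variables are not parents of C_i, so its row is fixed by v; the coarsening leaves
    two hard values, n_i with the probability of x and r_i otherwise. *)
Lemma binary_step (G : diagram C) (P : environment dom R G) p i x v :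
  None \notin Pa G (chance i) -> i \notin p ->
  (forall j, j \in p -> Some j \notin Pa G (chance i)) ->
  ev P (intervene (released p v) (binary x)) phi =
  response P p (upd v (r (Some i))) + P i (restrict _ v) x * effect P p i v.
Proof.
move=> NPa ip pPa.
have PaP j : Some j \in Pa G (chance i) ->
    j != i /\ released p v j = [ffun=> v (Some j)].
  move=> jPa; split.
    apply: contraTneq jPa => ->; rewrite inE; apply/negP => ii.
    have loop : path G (chance i) [:: chance i] by rewrite /= ii.
    by have := path_not_mem loop; rewrite mem_head.
  rewrite ffunE; case: ifP => // jp.
  by have := pPa j jp; rewrite jPa.
rewrite (ev_one_step _ _ _ NPa PaP) (bigD1 x) //=.
rewrite (eq_bigr (fun y => P i (restrict _ v) y * response P p (upd v (r (Some i))))).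
  have := mass_sum1 (P i (restrict _ v)); rewrite (bigD1 x) //= => sum1.
  rewrite -mulr_suml /effect ffunE eqxx intervene_hard // -/(response P p _).
  have -> : \sum_(y | y != x) P i (restrict _ v) y = 1 - P i (restrict _ v) x.
    by rewrite -sum1 addrC addrK.
  by ring.
by move=> y /negbTE yx; rewrite ffunE yx intervene_hard.
Qed.

Section Chordless.
Variables (G : diagram C) (P : environment dom R G) (Z : pred C).
Arguments P : clear implicits.

(** The list p holds the nodes after i. Only the last node of the path satisfies Z, and no node has
    an edge to a later one except its successor. *)
Fixpoint chordless (i : C) (p : seq C) : bool :=
  if p is j :: p' then
    [&& ~~ Z i, G (chance i) (chance j),
        all (fun k => ~~ G (chance i) (chance k)) p' & chordless j p']
  else Z i.

Lemma chordless_path i p : chordless i p -> path G (chance i) (map (@chance C) p).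
Proof. by elim: p i => //= j p IH i /and4P[_ -> _ /IH]. Qed.

(** Connect i to its last child on the path and drop the nodes before that child. *)
Lemma chordless_extend j p i : ~~ Z i -> chordless j p ->
  has (fun k => G (chance i) (chance k)) (j :: p) -> exists q, chordless i q.
Proof.
move=> Zi; elim: p j => [|k p IH] j /=.
  by rewrite orbF => Zj ij; exists [:: j]; rewrite /= Zi ij Zj.
case/and4P=> Zj jk nojp cp.
have [hp _|nhp] := boolP (has (fun k => G (chance i) (chance k)) (k :: p)).
  exact: IH cp hp.
move: (nhp) => /= /negbTE -> ; rewrite orbF => ij.
exists [:: j, k & p] => /=; rewrite Zi ij Zj jk nojp cp /= andbT.
by have := nhp; rewrite -all_predC.
Qed.

(** Induction along a directed path to U. A chance variable followed by D or U already satisfies Z,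
    so the chordless path stops before reaching the decision. *)
Lemma chordless_exists i :
  (forall j, G (chance j) (utility C) || G (chance j) (decision C) -> Z j) ->
  dipath G (chance i) (utility C) -> exists p, chordless i p.
Proof.
move=> ZP /existsP[x /andP[ix /connectP[q xq qU]]].
elim: q x i xq qU ix => [|y q IH] x i /=; first by move=> _ <- ix; exists [::]; rewrite /= ZP ?ix.
case/andP=> xy yq qU ix.
have [Zi|Zi] := boolP (Z i); first by exists [::].
case: x xy ix => [[j|]|] xy ix.
- have [p cp] := IH y j yq qU xy.
  by apply: (chordless_extend Zi cp) => /=; rewrite ix.
- by rewrite ZP ?orbT // in Zi; rewrite /decision ix orbT.
- by have := utility_sink G y; rewrite xy.
Qed.

Hypothesis phiZ : forall k v (y : dom (Some k)), ~~ Z k ->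
  response P [::] (upd v y) = response P [::] v.

Lemma chance_inj : injective (@chance C).
Proof. by move=> i j []. Qed.

Lemma path_source_free (G' : diagram C) j p :
  path G' (chance j) (map (@chance C) p) ->
  j \notin p /\ forall k, k \in p -> Some k \notin Pa G' (chance j).
Proof.
move=> jp; split; first by have := path_not_mem jp; rewrite mem_map //; exact: chance_inj.
by move=> k kp; rewrite inE; apply: (path_no_return jp); rewrite map_f.
Qed.

Lemma response_cons (j : C) p v : None \notin Pa G (chance j) ->
  path G (chance j) (map (@chance C) p) ->
  response P (j :: p) v =
  response P p (upd v (r (Some j))) + P j (restrict _ v) (n j) * effect P p j v.
Proof.
move=> NPa /path_source_free[jp pPa].
by rewrite -(binary_step _ _ _ NPa) // intervene_binary.
Qed.

(** C_k enters neither the final contrast, as it lies outside Z, nor any mechanism released along p,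
    as it has no edge into p. *)
Lemma response_indep p k v (y : dom (Some k)) :
  {in p, forall l, None \notin Pa G (chance l)} ->
  sorted G (map (@chance C) p) -> k \notin p -> ~~ Z k ->
  {in p, forall l, ~~ G (chance k) (chance l)} ->
  response P p (upd v y) = response P p v.
Proof.
elim: p v => [|j p IH] v NP sp kp Zk nok; first exact: phiZ.
have NPj : None \notin Pa G (chance j) by apply: NP; rewrite mem_head.
have {}IH w : response P p (upd w y) = response P p w.
  apply: IH => // [l lp|||l lp].
  - by apply: NP; rewrite inE lp orbT.
  - exact: path_sorted sp.
  - by apply: contraNN kp => kp; rewrite inE kp orbT.
  - by apply: nok; rewrite inE lp orbT.
have kj : Some k != Some j.
  by apply: contraNneq kp => -[->]; rewrite mem_head.
rewrite !response_cons // /effect !(updC _ _ _ kj) !IH.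
congr (_ + P j _ _ * _); apply: restrict_upd.
by rewrite inE; apply: nok; rewrite mem_head.
Qed.

(** Without chords, C_i acts on the contrast through C_j alone, so the effect is the change of
    P(n_j) times the effect of C_j. *)
Lemma effect_cons i j p v :
  {in i :: j :: p, forall l, None \notin Pa G (chance l)} ->
  chordless i (j :: p) ->
  effect P (j :: p) i v =
  (P j (restrict _ (upd v (n i))) (n j) -
   P j (restrict _ (upd v (r (Some i)))) (n j)) * effect P p j v.
Proof.
move=> NP cip; have := cip => /= /and4P[Zi ij noip cjp].
have sp := chordless_path cjp.
have NPj : None \notin Pa G (chance j) by apply: NP; rewrite !inE eqxx orbT.
have [ijp _] := path_source_free (chordless_path cip).
have neq : Some i != Some j by apply: contraNneq ijp => -[->]; rewrite mem_head.
have indep w (y : dom (Some i)) : response P p (upd w y) = response P p w.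
  apply: response_indep => // [l lp|||].
  - by apply: NP; rewrite !inE lp !orbT.
  - exact: path_sorted sp.
  - by apply: contraNN ijp => ip; rewrite inE ip orbT.
  - by move=> l /(allP noip).
rewrite {1}/effect !response_cons // /effect !(updC _ _ _ neq) !indep.
by ring.
Qed.

Lemma effect_neq0 i p :
  {in i :: p, forall l, None \notin Pa G (chance l)} ->
  (forall i j v, G (chance i) (chance j) ->
     P j (restrict _ (upd v (n i))) (n j) !=
     P j (restrict _ (upd v (r (Some i)))) (n j)) ->
  (forall v, effect P [::] (last i p) v != 0) ->
  chordless i p -> forall v, effect P p i v != 0.
Proof.
move=> NP Pgen; elim: p i NP => [|j p IH] i NP base cip v //.
rewrite effect_cons // mulf_neq0 //.
  by rewrite subr_eq0 Pgen //; case/and4P: cip.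
apply: IH => //; last by case/and4P: cip.
by move=> l lp; apply: NP; rewrite inE lp orbT.
Qed.

End Chordless.
(** Here q is the ratio (a - b) / (h - b); the equations avoid division, since h' - b' might vanish,
    and the bound on q' controls the error instead. The factor 4 collects one eps for a, one for b
    and two for h - b. *)
Lemma ratio_stable (a b h a' b' h' q q' eps : R) :
  a = b + q * (h - b) -> a' = b' + q' * (h' - b') -> 0 <= q' <= 1 ->
  `|a - a'| <= eps -> `|b - b'| <= eps -> `|h - h'| <= eps ->
  `|q - q'| * `|h - b| <= 4 * eps.
Proof.
move=> -> -> /andP[q0 q1]; rewrite -normrM.
set A := _ - (b' + _) => hA hb hh.
have -> : (q - q') * (h - b) = A - (b - b') - q' * ((h - h') - (b - b')).
  by rewrite /A; ring.
have hq : `|q' * ((h - h') - (b - b'))| <= 2 * eps.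
  rewrite normrM (ger0_norm q0).
  have h1 : `|(h - h') - (b - b')| <= 2 * eps.
    by rewrite (le_trans (ler_normB _ _)) //; lra.
  by apply: le_trans h1; rewrite -[leRHS]mul1r ler_wpM2r.
have h2 := ler_normB (A - (b - b')) (q' * ((h - h') - (b - b'))).
have h3 := ler_normB A (b - b'); lra.
Qed.

Lemma cpt_step_stable (G G' : diagram C) (P : environment dom R G)
    (P' : environment dom R G') i p (e eps : R) v x :
  None \notin Pa G (chance i) -> path G (chance i) (map (@chance C) p) ->
  None \notin Pa G' (chance i) -> path G' (chance i) (map (@chance C) p) ->
  (forall f, `|ev P f phi - ev P' f phi| <= eps) ->
  0 < e -> e <= `|effect P p i v| ->
  `|P i (restrict _ v) x - P' i (restrict _ v) x| <= 4 * eps / e.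
Proof.
move=> NPi /path_source_free[ip pPa] NPi' /path_source_free[_ pPa'] close e0 le_e.
have q01 : 0 <= P' i (restrict _ v) x <= 1 by rewrite mass_ge0 dist_le1.
have := ratio_stable (binary_step P x v NPi ip pPa) (binary_step P' x v NPi' ip pPa')
  q01 (close _) (close _) (close _).
rewrite -/(effect P p i v) ler_pdivlMr // => h; apply: le_trans h.
by rewrite ler_wpM2l.
Qed.

Lemma cpt_stable (G : diagram C) (P : environment dom R G) (Z : pred C) (C0 : R) i p :
  0 <= C0 ->
  (forall k v (y : dom (Some k)), ~~ Z k ->
     response P [::] (upd v y) = response P [::] v) ->
  {in i :: p, forall l, None \notin Pa G (chance l)} ->
  (forall i j v, G (chance i) (chance j) ->
     P j (restrict _ (upd v (n i))) (n j) !=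
     P j (restrict _ (upd v (r (Some i)))) (n j)) ->
  (forall v, effect P [::] (last i p) v != 0) ->
  chordless G Z i p ->
  exists2 K : R, 0 <= K &
  forall (G' : diagram C) (P' : environment dom R G') delta,
    0 <= delta -> K * delta < 1 ->
    (forall f, `|ev P f phi - ev P' f phi| <= C0 * delta) ->
    (forall k, connect G' (chance k) (chance (last i p)) ->
       None \notin Pa G' (chance k)) ->
    path G' (chance i) (map (@chance C) p) /\
    forall v x, `|P i (restrict _ v) x - P' i (restrict _ v) x| <= K * delta.
Proof.
move=> C00 phiZ NP Pgen base.
elim: p i NP base => [|j p IH] i NP base cip.
  have /finite_pos_lower_bound[e e0 eP] : forall v, 0 < `|effect P [::] i v|.
    by move=> v; rewrite normr_gt0; apply: base.
  exists (4 * C0 / e) => [|G' P' delta delta0 _ close NP'].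
    by rewrite divr_ge0 ?mulr_ge0 // ltW.
  split=> // v x; have NPi : None \notin Pa G (chance i) by apply: NP; rewrite mem_head.
  have -> : 4 * C0 / e * delta = 4 * (C0 * delta) / e by ring.
  have NPi' := NP' i (connect0 _ _).
  exact: (@cpt_step_stable G G' P P' i [::]) (eP v).
have NPi : None \notin Pa G (chance i) by apply: NP; rewrite mem_head.
have cjp : chordless G Z j p by case/and4P: cip.
have ij : G (chance i) (chance j) by case/and4P: cip.
have NPj : {in j :: p, forall l, None \notin Pa G (chance l)}.
  by move=> l lp; apply: NP; rewrite inE lp orbT.
have [K1 K10 stable] := IH j NPj base cjp.
have /finite_pos_lower_bound[e e0 eP] : forall v, 0 < `|effect P (j :: p) i v|.
  by move=> v; rewrite normr_gt0; exact: (effect_neq0 phiZ NP Pgen base cip).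
pose a y := P j (restrict _ (upd r (y : dom (Some i)))) (n j).
have gap0 : 0 < `|a (n i) - a (r (Some i))| by rewrite normr_gt0 subr_eq0 Pgen.
set gap := `|_| in gap0.
(* The first term is the error of the step itself. Under K delta < 1 the second gives the smallness
   required by the induction hypothesis, and the third gives 2 K1 delta < gap. *)
exists (4 * C0 / e + K1 + 2 * K1 / gap) => [|G' P' delta delta0 small close NP'].
  by rewrite !addr_ge0 // divr_ge0 ?mulr_ge0 // ltW.
have t1 : 0 <= 4 * C0 / e * delta by rewrite mulr_ge0 // divr_ge0 ?mulr_ge0 // ltW.
have t2 : 0 <= K1 * delta by rewrite mulr_ge0.
have t3 : 0 <= 2 * K1 / gap * delta by rewrite mulr_ge0 // divr_ge0 ?mulr_ge0 // ltW.
have t4 : 2 * (K1 * delta) < gap.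
  have : 2 * K1 / gap * delta < 1 by lra.
  by rewrite mulrAC ltr_pdivrMr // mul1r mulrA.
have [|path' near] := stable G' P' delta delta0 _ close NP'; first by lra.
have ij' : G' (chance i) (chance j).
  (* Without the edge, P' at j would be the same for C_i = n_i and C_i = r_i, hence within K1 delta
     of two numbers that are gap apart. *)
  apply: contraT => nij.
  have iPa' : Some i \notin Pa G' (chance j) by rewrite inE.
  have := near (upd r (n i)) (n j); have := near (upd r (r (Some i))) (n j).
  rewrite -/(a _) -/(a _) !restrict_upd //.
  move: t4; rewrite /gap => t4 h1 h2.
  have := ler_distD (P' j (restrict _ r) (n j)) (a (n i)) (a (r (Some i))).
  rewrite [`|P' j _ _ - _|]distrC; lra.
have pij' : path G' (chance i) (map (@chance C) (j :: p)) by rewrite /= ij'.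
split=> // v x.
have NPi' : None \notin Pa G' (chance i).
  apply: NP'; apply: connect_trans (connect1 ij') _.
  by apply/connectP; exists (map (@chance C) p); rewrite ?last_map.
apply: le_trans (_ : 4 * (C0 * delta) / e <= _).
  exact: cpt_step_stable (chordless_path cip) NPi' pij' close e0 (eP v).
rewrite (_ : 4 * (C0 * delta) / e = 4 * C0 / e * delta); first by lra.
by ring.
Qed.

End Contrast.
End Paths.

(** * Domain dependence *)

Section Dominance.
Variables (C : finType) (dom : option C -> finType) (R : realType).

Local Notation asg := (assignment dom).

(** Exchanging v w with x is an involution on the pairs (v, x). *)
Lemma sum_upd (w : option C) (F : asg -> R) :
  \sum_v \sum_(x : dom w) F (upd v x) = #|dom w|%:R * \sum_v F v.
Proof.
rewrite pair_bigA /=.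
pose swap (p : asg * dom w) := (upd p.1 p.2, p.1 w).
have swapK : involutive swap.
  by case=> v x; rewrite /swap /= upd_upd upd_id upd_in.
rewrite (reindex_inj (inv_inj swapK)) /=.
rewrite (eq_bigr (fun p : asg * dom w => F p.1)); last first.
  by move=> p _; rewrite upd_upd upd_id.
rewrite -(pair_bigA _ (fun v _ => F v)) /= mulr_sumr.
by apply: eq_bigr => v _; rewrite sumr_const mulr_natl.
Qed.

(** Sums run over full assignments, so the right-hand side counts every value of h once per state of
    w; this is the factor on the left. *)
Lemma sum_out_one (w : option C) (k h : asg -> R) :
  (forall v, \sum_(x : dom w) k (upd v x) = 1) ->
  (forall v (x : dom w), h (upd v x) = h v) ->
  #|dom w|%:R * (\sum_v k v * h v) = \sum_v h v.
Proof.
move=> k1 hE; rewrite -sum_upd; apply: eq_bigr => v _.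
by rewrite -[RHS]mul1r -(k1 v) mulr_suml; apply: eq_bigr => x _; rewrite hE.
Qed.

(** Take a member of B that reaches the fewest nodes: a child in B would reach fewer, since by
    acyclicity it cannot reach w. *)
Lemma exists_sink (G : diagram C) (B : {set option C}) : B != set0 ->
  exists2 w, w \in B & forall w', w' \in B -> ~~ G (Some w) (Some w').
Proof.
case/set0Pn=> w0 w0B; pose down w := #|[set x | connect G (Some w) x]|.
case: (@arg_minnP _ w0 (mem B) down w0B) => w wB wmin; exists w => // w' w'B.
apply/negP => ww'; have := wmin w' w'B; rewrite leqNgt => /negP[].
apply: proper_card; apply/properP; split.
  apply/subsetP => x; rewrite !inE; apply: connect_trans; exact: connect1.
exists (Some w); rewrite inE ?connect0 //.
apply: contraNN (diagram_acyclic G (Some w)) => w'w.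
by apply/existsP; exists (Some w'); rewrite ww'.
Qed.

(** Sum out a sink of B first: its own kernel is the only remaining factor that depends on it. *)
Lemma sum_out (G : diagram C) (k : option C -> asg -> R) (B : {set option C}) h :
  (forall w v, \sum_(x : dom w) k w (upd v x) = 1) ->
  (forall w w' v (x : dom w'), w' != w -> ~~ G (Some w') (Some w) ->
     k w (upd v x) = k w v) ->
  (forall w v (x : dom w), w \in B -> h (upd v x) = h v) ->
  (\prod_(w in B) #|dom w|%:R) * (\sum_v (\prod_(w in B) k w v) * h v) = \sum_v h v.
Proof.
move=> k1 kdep; have [m] := ubnP #|B|; elim: m B h => // m IH B h cB hB.
have [->|B0] := eqVneq B set0.
  by rewrite big_set0 mul1r; apply: eq_bigr => v _; rewrite big_set0 mul1r.
have [w wB sink] := exists_sink G B0.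
have cBw : (#|B :\ w| < m)%N by move: cB; rewrite (cardsD1 w) wB.
rewrite (big_setD1 w) //= [X in X * _ = _]mulrC -mulrA.
rewrite [X in _ * (_ * X)](eq_bigr (fun v => k w v * ((\prod_(w' in B :\ w) k w' v) * h v))).
  rewrite sum_out_one //; first rewrite IH //.
  - by move=> w' v x; rewrite !inE => /andP[_]; apply: hB.
  - move=> v x; rewrite hB //; congr (_ * _); apply: eq_bigr => w'.
    by rewrite !inE => /andP[w'w w'B]; rewrite kdep // 1?eq_sym // sink.
by move=> v _; rewrite (big_setD1 w) //= mulrA.
Qed.

Lemma prod_option (F : option C -> R) : \prod_w F w = F None * \prod_i F (Some i).
Proof.
rewrite (bigD1 None) //=; congr (_ * _).
rewrite (reindex_omap Some id) /=; last by case.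
by apply: eq_bigl => i; rewrite eqxx.
Qed.

(** Always playing d0 is optimal. Replacing the decision by d0 inside the payoff gives [best], which
    bounds the payoff and, the task being unmediated, does not depend on D or its descendants.
    Summing these out shows that the expectation of [best] is the same under every policy, and the
    constant policy attains it. *)
Lemma dominating_optimal (r : asg) (G : diagram C) (M : cid dom R G) (d0 : dom None) :
  unmediated G ->
  (forall v (d : dom None), payoff M (upd v d) <= payoff M (upd v d0)) ->
  exists pi : policy dom R, forall P : environment dom R G,
    optimal (EU (util M) P) pi.
Proof.
move=> unm dominates; have [q hq] := @point_mass R _ d0.
pose pi0 : policy dom R := fun _ _ => q; exists pi0 => P pi.
pose u (v : asg) := payoff M v; pose best (v : asg) := u (upd v (w := None) d0).
pose k (pi1 : policy dom R) w v : R := match w with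
  | Some i => cpt_int P (no_int dom) (restrict (Pa G (chance i)) v) (v (Some i))
  | None => pi1 _ (restrict (Pa G (decision C) :\: set0) v) (v None)
  end.
have EUE pi1 : EU (util M) P pi1 = \sum_v (\prod_w k pi1 w v) * u v.
  by apply: eq_bigr => v _; rewrite prod_option; congr (_ * _); apply: mulrC.
have k_ge0 pi1 w v : 0 <= k pi1 w v.
  by case: w => [i|]; [apply: sumr_ge0 => x _|]; apply: mass_ge0.
pose B := [set w : option C | connect G (decision C) (Some w)].
have noret (w : node C) : ~~ G w w.
  apply: contraNN (diagram_acyclic G w) => ww.
  by apply/existsP; exists w; rewrite ww connect0.
have kdep pi1 w w' v (x : dom w') : w' != w -> ~~ G (Some w') (Some w) ->
    k pi1 w (upd v x) = k pi1 w v.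
  case: w => [i|] w'w nedge /=.
    by rewrite upd_out // restrict_upd // inE.
  by rewrite upd_out // restrict_upd // !inE.
have k1 pi1 w v : \sum_(x : dom w) k pi1 w (upd v x) = 1.
  case: w => [i|] /=.
    rewrite -(mass_sum1 (P i (restrict _ v))); apply: eq_bigr => x _.
    rewrite upd_in restrict_upd ?inE ?noret // /cpt_int.
    by rewrite (big_pred1 x) // => y; rewrite !ffunE.
  rewrite -(mass_sum1 (pi1 _ (restrict (Pa G (decision C) :\: set0) v))).
  by apply: eq_bigr => x _; rewrite upd_in restrict_upd // !inE noret.
have best_indep w v (x : dom w) : w \in B -> best (upd v x) = best v.
  rewrite inE => Dw; rewrite /best; case: w x Dw => [i|] x Dw; last by rewrite upd_upd.
  rewrite updC // /u /payoff restrict_upd // inE; apply/negP => iU.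
  have: chance i \in Desc G (decision C) :&: Anc G (utility C).
    rewrite !inE; apply/andP; split; apply/existsP.
      case/connectP: Dw => -[|y p] //= /andP[Dy yp] E.
      by exists y; rewrite Dy; apply/connectP; exists p.
    by exists (utility C); rewrite iU connect0.
  by rewrite unm inE.
(* Since D lies in B, T has the same value for every policy. *)
pose T := \sum_v (\prod_(w | w \notin B) k pi0 w v) * best v.
pose K : R := \prod_(w in B) #|dom w|%:R.
have DB : None \in B by rewrite inE connect0.
have bestE pi1 : K * (\sum_v (\prod_w k pi1 w v) * best v) = T.
  pose h v := (\prod_(w | w \notin B) k pi1 w v) * best v.
  have <- : \sum_v h v = T.
    apply: eq_bigr => v _; congr (_ * _); apply: eq_bigr => -[i|] //.
    by rewrite DB.
  have hB w v (x : dom w) : w \in B -> h (upd v x) = h v.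
    move=> wB; rewrite /h best_indep //; congr (_ * _); apply: eq_bigr => w' w'B.
    apply: kdep; first by apply: contraNneq w'B => <-.
    apply: contraNN w'B => ww'; rewrite inE in wB; rewrite inE.
    exact: connect_trans wB (connect1 ww').
  rewrite -(sum_out (k1 pi1) (kdep pi1) hB); congr (_ * _).
  by apply: eq_bigr => v _; rewrite (bigID (mem B)) /= mulrA.
have K0 : 0 < K.
  apply: prodr_gt0 => w _; rewrite ltr0n; apply/card_gt0P.
  by exists (r w).
have up : \sum_v (\prod_w k pi w v) * u v <= \sum_v (\prod_w k pi w v) * best v.
  apply: ler_sum => v _; apply: ler_wpM2l; first exact: prodr_ge0.
  by rewrite -{1}(upd_id v None) /best; apply: dominates.
rewrite !EUE (le_trans up) // -(ler_pM2l K0) bestE -(bestE pi0) le_eqVlt.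
apply/orP; left; apply/eqP; congr (_ * _); apply: eq_bigr => v _.
have [E|ne] := eqVneq (v None) d0; first by rewrite /best -E upd_id.
by rewrite prod_option /= hq (negbTE ne) !mul0r.
Qed.

End Dominance.

(** * Stability of the mechanisms *)

Section Stability.
Variables (C : finType) (dom : option C -> finType) (R : realType).

Local Notation asg := (assignment dom).

Lemma dipath_step (G : diagram C) (x y z : node C) :
  connect G x y -> G y z -> dipath G x z.
Proof.
case/connectP=> -[|w p] /= => [_ -> xz|/andP[xw wp] -> yz]; apply/existsP.
  by exists z; rewrite xz connect0.
exists w; rewrite xw; apply: connect_trans (connect1 yz).
by apply/connectP; exists p.
Qed.

Definition relevant (G : diagram C) : pred C :=
  fun k => (Some k \in Pa G (utility C)) || (Some k \in Pa G (decision C)).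

(** Otherwise C_k descends from D, and it reaches U through C_t, if need be via D, which is a parent
    of U. *)
Lemma no_decision_parent (G : diagram C) k t :
  unmediated G -> None \in Pa G (utility C) -> relevant G t ->
  connect G (chance k) (chance t) -> None \notin Pa G (chance k).
Proof.
rewrite /relevant !inE => unm DU Zt kt; apply/negP => Dk.
have : chance k \in Desc G (decision C) :&: Anc G (utility C).
  rewrite !inE (dipath_step (connect0 _ _) Dk) /=; case/orP: Zt => tU.
    exact: dipath_step tU.
  exact: dipath_step (connect_trans kt (connect1 tU)) DU.
by rewrite unm inE.
Qed.

Lemma decision_not_own_parent (G : diagram C) : None \notin Pa G (decision C).
Proof.
rewrite inE; apply/negP => DD.
by have /negP[] := diagram_acyclic G (decision C); apply: dipath_step DD.
Qed.

Lemma strict_best (G : diagram C) (M : cid dom R G) (d0 : dom None) (c : asg) :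
  (forall d d' : dom None, d != d' -> payoff M (upd c d) != payoff M (upd c d')) ->
  exists (b : dom None) (eta : R), 0 < eta /\
    forall d, d != b -> payoff M (upd c d) + eta <= payoff M (upd c b).
Proof.
move=> ties; have [b bP] := finite_argmax d0 (fun d : dom None => payoff M (upd c d)).
pose f d := if d == b then 1 else payoff M (upd c b) - payoff M (upd c d).
have [d|eta eta0 etaP] := finite_pos_lower_bound (_ : forall d, 0 < f d).
  rewrite /f; case: eqVneq => // db; rewrite subr_gt0 lt_neqAle bP andbT.
  exact: ties.
exists b, eta; split=> // d db; have := etaP d.
by rewrite /f (negbTE db) lerBrDr addrC.
Qed.

(** If U did not read D, every decision would dominate. Otherwise let d1 be best at r; as d1 does
    not dominate, it is beaten at some c2, where d2 is best. The absence of ties makes both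
    strict. *)
Lemma preference_reversal (r : asg) (G : diagram C) (M : cid dom R G) :
  unmediated G -> domain_dependent M ->
  (None \in Pa G (utility C) -> forall (c : asg) (d d' : dom None), d != d' ->
     payoff M (upd c d) != payoff M (upd c d')) ->
  None \in Pa G (utility C) /\
  exists (c1 c2 : asg) (d1 d2 : dom None) (eta : R),
    [/\ d1 != d2, 0 < eta,
        forall d, d != d1 -> payoff M (upd c1 d) + eta <= payoff M (upd c1 d1)
      & forall d, d != d2 -> payoff M (upd c2 d) + eta <= payoff M (upd c2 d2)].
Proof.
move=> unm [P1 [P2 dd]] ties.
have nodom (d0 : dom None) :
    ~ forall v (d : dom None), payoff M (upd v d) <= payoff M (upd v d0).
  by move=> /(dominating_optimal r unm)[pi opt]; exact: (dd pi (opt P1) (opt P2)).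
have DU : None \in Pa G (utility C).
  apply: contraT => DU; case: (nodom (r None)) => v d.
  by rewrite /payoff !restrict_upd.
split=> //; have {}ties := ties DU.
have [d1 [e1 [e10 g1]]] := @strict_best G M (r None) r (ties r).
have [c2 [d c2d]] : exists (c : asg) (d : dom None), payoff M (upd c d1) < payoff M (upd c d).
  apply: boolp.contrapT => H; apply: (nodom d1) => v d.
  by rewrite leNgt; apply/negP => lt; apply: H; exists v, d.
have [d2 [e2 [e20 g2]]] := @strict_best G M (r None) c2 (ties c2).
exists r, c2, d1, d2, (Num.min e1 e2); split.
- apply: contraTneq c2d => ->; rewrite -leNgt.
  have [->//|/g2] := eqVneq d d2; lra.
- by rewrite lt_min e10.
- move=> x /g1; apply: le_trans; rewrite lerD2l; by rewrite ge_min lexx.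
- move=> x /g2; apply: le_trans; rewrite lerD2l; by rewrite ge_min lexx orbT.
Qed.

(** * Generic parameters and the stability of one mechanism *)

Section Generic.
Variables (r : asg) (n : forall i : C, dom (Some i)).
Hypothesis nr : forall i, n i != r (Some i).
Variables (G : diagram C) (M : cid dom R G).
Hypothesis generic : ~ degenerate (@param C dom R G r M).

Lemma param_range t : 0 <= @param C dom R G r M t <= 1.
Proof.
case: t => [[i cx]|c] /=; last exact: util_range.
by rewrite mass_ge0 dist_le1.
Qed.

Lemma generic_neq k1 k2 k3 k4 : k2 != k1 -> k3 != k1 -> k4 != k1 ->
  param M k1 != param M k2 + param M k3 - @param C dom R G r M k4.
Proof.
move=> h2 h3 h4; apply/negP => /eqP E; apply: generic; split; first exact: param_range.
by exists k1, k2, k3, k4; split.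
Qed.

Lemma restrict_upd_neq (S : {set option C}) w (v : asg) (x y : dom w) :
  w \in S -> x != y -> restrict S (upd v x) != restrict S (upd v y).
Proof.
move=> wS; apply: contraNneq => /eqP/restrictP/(_ w wS).
by rewrite !upd_in => ->.
Qed.

(** Since n_j is not the reference state, both entries are free parameters, and they sit in
    different rows; this is the case k2 = k3 = k4 of [generic_neq]. *)
Lemma generic_cpt i j v : G (chance i) (chance j) ->
  cpt M (restrict (Pa G (chance j)) (upd v (n i))) (n j) !=
  cpt M (restrict (Pa G (chance j)) (upd v (r (Some i)))) (n j).
Proof.
move=> ij; pose par c : free_param G r := inl (Tagged
  (fun j => (config dom (Pa G (chance j)) * {x : dom (Some j) | x != r (Some j)})%type)
  (c, Sub (n j) (nr j))).
have ne : par (restrict _ (upd v (r (Some i)))) != par (restrict _ (upd v (n i))).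
  rewrite (inj_eq inl_inj) eq_Tagged xpair_eqE eqxx andbT eq_sym.
  by apply: restrict_upd_neq; rewrite ?inE.
by have := generic_neq ne ne ne; rewrite addrK.
Qed.

Lemma generic_payoff w v (x y : dom w) : w \in Pa G (utility C) -> x != y ->
  payoff M (upd v x) != payoff M (upd v y).
Proof.
move=> wU xy; pose par c : free_param G r := inr c.
have ne : par (restrict _ (upd v y)) != par (restrict _ (upd v x)).
  by rewrite (inj_eq inr_inj) eq_sym restrict_upd_neq.
by have := generic_neq ne ne ne; rewrite addrK.
Qed.

(** A second difference of the utility. If it vanished, C_i would shift the payoffs of d and d'
    alike and their contrast could not reveal it. *)
Lemma generic_interaction i v (d d' : dom None) :
  Some i \in Pa G (utility C) -> None \in Pa G (utility C) -> d != d' ->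
  payoff M (upd (upd v (n i)) d) - payoff M (upd (upd v (n i)) d') !=
  payoff M (upd (upd v (r (Some i))) d) - payoff M (upd (upd v (r (Some i))) d').
Proof.
move=> iU DU dd'; pose par c : free_param G r := inr (restrict _ c).
have ne (e e' : dom None) : par (upd (upd v (r (Some i))) e') != par (upd (upd v (n i)) e).
  rewrite (inj_eq inr_inj); apply/negP => /restrictP/(_ _ iU).
  rewrite !(upd_out _ (w := None)) // !upd_in => E.
  by have := nr i; rewrite -E eqxx.
have ne' : par (upd (upd v (n i)) d') != par (upd (upd v (n i)) d).
  by rewrite (inj_eq inr_inj) eq_sym restrict_upd_neq.
have := generic_neq ne' (ne d d) (ne d d').
rewrite /= -!/(payoff M _); apply: contraNneq; lra.
Qed.

(** The closed form of the contrast between d and d' when all chance variables are held at v. *)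
Definition visible (S : {set option C}) (o : asg) (d d' : dom None) (v : asg) : R :=
  (restrict S v == restrict S o)%:R * (payoff M (upd v d) - payoff M (upd v d')).

(* If C_t is a parent of U, mask everything; otherwise let the agent observe
   C_t alone and look at its decision when C_t = n_t. *)
Lemma exposing_mask t (c1 c2 : asg) (d d' : dom None) :
  relevant G t -> None \in Pa G (utility C) -> d != d' ->
  exists (m : {set option C}) (o c1' c2' : asg),
    let S := Pa G (decision C) :\: m in
    [/\ restrict S c1' = restrict S o, restrict S c2' = restrict S o,
        forall e : dom None, payoff M (upd c1' e) = payoff M (upd c1 e),
        forall e : dom None, payoff M (upd c2' e) = payoff M (upd c2 e)
      & forall v, visible S o d d' (upd v (n t)) - visible S o d d' (upd v (r (Some t))) != 0].
Proof.
move=> Zt DU dd'; have [tU|tU] := boolP (Some t \in Pa G (utility C)).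
  exists setT, r, c1, c2 => S.
  have all_eq (c c' : asg) : restrict S c = restrict S c'.
    by apply/eqP/restrictP => w; rewrite /S setDT inE.
  split=> // v; rewrite /visible !(all_eq _ r) eqxx !mul1r subr_eq0.
  exact: generic_interaction.
have tD : Some t \in Pa G (decision C) by move: Zt; rewrite /relevant (negbTE tU).
(* Setting C_t to n_t in c1 and c2 makes both produce the observation; payoffs are unchanged because
   C_t is not a parent of U. *)
exists (~: [set Some t]), (upd r (n t)), (upd c1 (n t)), (upd c2 (n t)) => S.
have SP w : w \in S -> w = Some t by rewrite !inE negbK => /andP[/eqP].
have tS : Some t \in S by rewrite in_setD tD !inE eqxx.
have same v : restrict S (upd v (n t)) = restrict S (upd r (n t)).
  by apply/eqP/restrictP => w /SP ->; rewrite !upd_in.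
have inv v (x : dom (Some t)) (e : dom None) :
    payoff M (upd (upd v x) e) = payoff M (upd v e).
  by rewrite updC // /payoff restrict_upd.
split=> // v; rewrite /visible same eqxx.
have /negbTE -> : restrict S (upd v (r (Some t))) != restrict S (upd r (n t)).
  by rewrite -(same v) restrict_upd_neq // eq_sym.
by rewrite mul0r mul1r subr0 !inv subr_eq0 generic_payoff.
Qed.

Lemma chance_identified i : unmediated G -> domain_dependent M ->
  chance i \in Anc G (utility C) ->
  exists2 K : R, 0 <= K &
  forall (G' : diagram C) (M' : cid dom R G') delta (pi : mixture dom R -> policy dom R),
    0 <= delta -> unmediated G' ->
    Pa G' (decision C) = Pa G (decision C) -> Pa G' (utility C) = Pa G (utility C) ->
    payoff M' =1 payoff M ->
    (forall s, regret_le (EU_mix (util M) (cpt M) s) delta (pi s)) ->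
    (forall s, regret_le (EU_mix (util M') (cpt M') s) delta (pi s)) ->
    forall v x, `|cpt M (restrict (Pa G (chance i)) v) x -
                  cpt M' (restrict (Pa G' (chance i)) v) x| <= K * delta.
Proof.
move=> unm dd iU.
have [DU [c1 [c2 [d1 [d2 [eta [d12 eta0 g1 g2]]]]]]] :=
  preference_reversal r unm dd (fun DU c d d' => generic_payoff c DU).
have [p cp] : exists p, chordless G (relevant G) i p.
  apply: chordless_exists; last by rewrite inE in iU.
  by move=> j; rewrite /relevant !inE.
pose t := last i p.
have Zt : relevant G t.
  by rewrite /t; elim: p i cp {iU t} => //= j p IH i /and4P[_ _ _ /IH].
have NP : {in i :: p, forall l, None \notin Pa G (chance l)}.
  move=> l lp; apply: (no_decision_parent unm DU Zt).
  have := chordless_path cp; rewrite /t; elim: p i lp {cp iU t Zt} => [|j p IH] i.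
    by rewrite inE => /eqP -> _; apply: connect0.
  rewrite inE => /predU1P[->|lp] ijp; last by case/andP: ijp => _; apply: IH.
  by apply/connectP; exists (map (@chance C) (j :: p)); rewrite ?last_map.
have [m [o [c1' [c2' [E1 E2 u1 u2 vis]]]]] := exposing_mask c1 c2 Zt DU d12.
set S := Pa G (decision C) :\: m in E1 E2 vis.
have NS : None \notin S by rewrite in_setD (negbTE (decision_not_own_parent G)) andbF.
pose phi v := observed S o (payoff M) d1 v - observed S o (payoff M) d2 v.
have respE v : response r n phi (cpt M) [::] v = visible S o d1 d2 v.
  rewrite /response /visible mulrBr -!(ev_hard_observed (cpt M) o _ _ _ NS) -evB.
  by congr (ev _ _ _); apply/ffunP => j; rewrite !ffunE.
pose C0 : R := (#|{: asg}|%:R + eta) / eta * (#|{: dom None * dom None}|%:R * 4).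
have C00 : 0 <= C0.
  by rewrite /C0 mulr_ge0 ?divr_ge0 ?mulr_ge0 ?addr_ge0 ?ler0n // ltW.
have phiZ k v (y : dom (Some k)) : ~~ relevant G k ->
    response r n phi (cpt M) [::] (upd v y) = response r n phi (cpt M) [::] v.
  rewrite /relevant negb_or => /andP[kU kD]; rewrite !respE /visible.
  have kS : Some k \notin S by rewrite in_setD (negbTE kD) andbF.
  rewrite restrict_upd //; congr (_ * (_ - _));
    by rewrite updC // /payoff restrict_upd.
have base v : effect r n phi (cpt M) [::] t v != 0 by rewrite /effect !respE.
have [K K0 stable] := cpt_stable C00 phiZ NP generic_cpt base cp.
exists K => // G' M' delta pi delta0 unm' ED EU' Epay reg reg' v x.
(* For K delta at least 1 the bound is trivial, as both numbers are probabilities. *)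
have [big|small] := lerP 1 (K * delta).
  apply: le_trans big; rewrite ler_norml.
  have := mass_ge0 (cpt M (restrict (Pa G (chance i)) v)) x.
  have := dist_le1 (cpt M (restrict (Pa G (chance i)) v)) x.
  have := mass_ge0 (cpt M' (restrict (Pa G' (chance i)) v)) x.
  have := dist_le1 (cpt M' (restrict (Pa G' (chance i)) v)) x; lra.
have close f : `|ev (cpt M) f phi - ev (cpt M') f phi| <= C0 * delta.
  apply: (@contrast_identified _ _ _ G G' M M' m o c1' c2' d1 d2 eta delta pi) => //.
  - by move=> d; rewrite !u1; apply: g1.
  - by move=> d; rewrite !u2; apply: g2.
have [//|_] := stable G' (cpt M') delta delta0 small close.
  move=> k; apply: no_decision_parent => //; first by rewrite EU'.
  by move: Zt; rewrite /relevant ED EU'.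
by apply.
Qed.

End Generic.
End Stability.

(** * The identifier and its error bound *)

Lemma model_inhabited (R : realType) (C : finType) (dom : option C -> finType)
    (r : assignment dom) : exists m : model dom R, True.
Proof.
have acyclic (x : node C) : ~~ dipath (fun _ _ => false) x x.
  by apply/existsP => -[].
pose G := Diagram acyclic (fun _ => isT).
have U0 (c : config dom (Pa G (utility C))) : 0 <= (0 : R) <= 1 by rewrite lexx ler01.
pose q (i : C) := sval (boolp.cid (@point_mass R _ (r (Some i)))).
by exists (existT _ G (Cid (fun i _ => q i) U0)).
Qed.

(** Utility functions of different graphs have different domain types, so they are compared as
    functions of a full assignment. *)
Definition consistent (R : realType) (C : finType) (dom : option C -> finType)
    (PaD PaU : {set option C}) (U : config dom PaU -> R) (delta : R)
    (pi : mixture dom R -> policy dom R) (m : model dom R) : Prop :=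
  [/\ unmediated (projT1 m), Pa (projT1 m) (decision C) = PaD,
      Pa (projT1 m) (utility C) = PaU,
      forall v, payoff (projT2 m) v = U (restrict PaU v)
    & forall s, regret_le (EU_mix (util (projT2 m)) (cpt (projT2 m)) s) delta (pi s)].

(* The bound is asserted at every node except the chance variables that are not
   ancestors of U: those influence neither the observations of the agent nor
   E[U] in any domain, so no family of policies carries information on their
   conditional probabilities. *)
Theorem theorem2 (R : realType) (C : finType) (dom : option C -> finType)
    (r : assignment dom)
    (dom_gt1 : forall i : C, (1 < #|dom (Some i)|)%N) :
  exists identify : identifier dom R,
  forall G : diagram C, unmediated G ->
  almost_all G r (fun M : cid dom R G =>
    domain_dependent M ->
    exists gamma : R -> R,
    [/\ gamma 0 = 0,
        linear_for_small_regret M gamma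
      & forall (delta : R) (pi : mixture dom R -> policy dom R),
        0 <= delta ->
        (forall sigma,
           regret_le (EU_mix (util M) (cpt M) sigma) delta (pi sigma)) ->
        let M' := identify (Pa G (decision C)) (Pa G (utility C))
                           (util M) delta pi in
        forall x : node C, x \in utility C |: Anc G (utility C) ->
        forall (pol : policy dom R) (v : assignment dom) (u : R),
        `|cond_prob (projT2 M') pol v u x - cond_prob M pol v u x|
          <= gamma delta]).
Proof.
have n_ex (i : C) : exists x, x != r (Some i).
  by have /card_gt1P[x [y [_ _ xy]]] := dom_gt1 i;
     have [E|] := eqVneq x (r (Some i)); [exists y; rewrite -E eq_sym|exists x].
pose n i := xchoose (n_ex i).
have nr i : n i != r (Some i) := xchooseP (n_ex i).
(* The output for data that no model explains. *)
have [m0 _] := model_inhabited R r.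
pose identify : identifier dom R := fun PaD PaU U delta pi =>
  match boolp.pselect (exists m, consistent PaD U delta pi m) with
  | left ex => sval (boolp.cid ex)
  | right _ => m0
  end.
have identifyP PaD PaU (U : config dom PaU -> R) delta pi :
    (exists m, consistent PaD U delta pi m) ->
    consistent PaD U delta pi (identify PaD PaU U delta pi).
  by rewrite /identify; case: boolp.pselect => // ex _; exact: (svalP (boolp.cid ex)).
exists identify => G unm.
exists (@degenerate R (free_param G r)).
  (* A utility entry always exists, so the parameter space has at least one coordinate. *)
  exact: (degenerate_null (inr (restrict _ r))).
move=> M generic dd.
have /boolp.choice[K KP] (i : C) : exists K : R, 0 <= K /\
    (chance i \in Anc G (utility C) ->
     forall (G' : diagram C) (M' : cid dom R G') delta (pi : mixture dom R -> policy dom R),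
       0 <= delta -> unmediated G' ->
       Pa G' (decision C) = Pa G (decision C) -> Pa G' (utility C) = Pa G (utility C) ->
       payoff M' =1 payoff M ->
       (forall s, regret_le (EU_mix (util M) (cpt M) s) delta (pi s)) ->
       (forall s, regret_le (EU_mix (util M') (cpt M') s) delta (pi s)) ->
       forall v x, `|cpt M (restrict (Pa G (chance i)) v) x -
                     cpt M' (restrict (Pa G' (chance i)) v) x| <= K * delta).
  have [iU|iU] := boolP (chance i \in Anc G (utility C)); last by exists 0.
  by have [K K0 KP] := chance_identified nr generic unm dd iU; exists K.
(* This dominates every K i, and the summand 1 keeps the slope of gamma positive even if all K i
   vanish. *)
pose K1 : R := 1 + \sum_i K i.
have sumK0 : 0 <= \sum_i K i by apply: sumr_ge0 => i _; case: (KP i).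
have K1i i : K i <= K1.
  rewrite /K1 (bigD1 i) //=.
  have : 0 <= \sum_(j | j != i) K j by apply: sumr_ge0 => j _; case: (KP j).
  lra.
have K10 : 0 < K1 by rewrite /K1; lra.
exists (fun delta => K1 * delta); split; first by rewrite mulr0.
  by exists K1, 1.
move=> delta pi delta0 reg M' x xU pol v u.
have [unm' ED EU' Epay reg'] : consistent (Pa G (decision C)) (util M) delta pi M'.
  by apply: identifyP; exists (existT _ G M).
have bound0 : 0 <= K1 * delta by rewrite mulr_ge0 // ltW.
case: x xU => [[i|]|] xU /=.
- have iU : chance i \in Anc G (utility C) by move: xU; rewrite in_setU in_set1.
  have [_ /(_ iU) KPi] := KP i.
  rewrite distrC (le_trans (KPi (projT1 M') (projT2 M') delta pi _ _ _ _ _ _ _ v _)) //.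
  by rewrite ler_wpM2r.
- by rewrite ED subrr normr0.
- by have := Epay v; rewrite /payoff => ->; rewrite subrr normr0.
Qed.
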